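(* Let $K$ be a connected 4-regular simple graph with an odd number of vertices, and let $v$ and $w$ be vertices of $K$. Then $c_2^{(2)}(K-v) = c_2^{(2)}(K-w)$.
   Context: For a graph $G$, assign a variable $a_e$ to each edge $e$ and let the Kirchhoff polynomial be $\Psi_G=\sum_T\prod_{e\notin T}a_e$, where the sum runs over all spanning trees $T$ of $G$. For a prime $p$ and a connected graph $G$ with at least 3 vertices, let $[\Psi_G]_p$ be the number of $\mathbb{F}_p$-rational points of the affine variety $\{\Psi_G=0\}\subseteq \mathbb{F}_p^{|E(G)|}$. The $c_2$ invariant is $c_2^{(p)}(G)=[\Psi_G]_p/p^2 \bmod p$ (this is known to be well defined). $K-v$ denotes $K$ with the vertex $v$ and its incident edges removed. *)

(* Defs.v *)
From mathcomp Require Import all_boot all_algebra.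
Set Implicit Arguments. Unset Strict Implicit. Unset Printing Implicit Defensive.
Import GRing.Theory.

(* A simple graph on a finite vertex type V is given by a symmetric,
   irreflexive relation adj.  For S : {set V} we consider the induced
   subgraph G[S] (for K - v, S = [set: V] :\ v). *)

Section Kirchhoff.
Variables (V : finType) (adj : rel V).

Definition edge_set (S : {set V}) : {set {set V}} :=
  [set e : {set V} | [exists x in S, [exists y in S, adj x y && (e == [set x; y])]]].

Definition edge_t (S : {set V}) := {e : {set V} | e \in edge_set S}.

Variable S : {set V}.

Definition tadj (T : {set edge_t S}) : rel V :=
  fun x y => [exists e in T, val e == [set x; y]].

Definition sub_connected (T : {set edge_t S}) : bool :=
  [forall x in S, [forall y in S, connect (tadj T) x y]].

(* (S,T) has no cycle: no cyclic sequence of >= 3 distinct vertices with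
   consecutive vertices joined by an edge of T (a cycle has at most #|V|
   vertices, so bounding the length loses nothing) *)
Definition sub_acyclic (T : {set edge_t S}) : bool :=
  ~~ [exists k : 'I_(#|V|).+1, [exists t : k.-tuple V,
        (3 <= k) && uniq t && cycle (tadj T) t]].

Definition spanning_tree (T : {set edge_t S}) : bool :=
  sub_connected T && sub_acyclic T.

Definition kirchhoff_eval (p : nat) (a : {ffun edge_t S -> 'F_p}) : 'F_p :=
  (\sum_(T : {set edge_t S} | spanning_tree T) \prod_(e in ~: T) a e)%R.

Definition psi_count (p : nat) : nat :=
  #|[set a : {ffun edge_t S -> 'F_p} | kirchhoff_eval a == 0%R]|.

Definition c2 (p : nat) : nat := (psi_count p %/ p ^ 2) %% p.

End Kirchhoff.

Definition c2_del (V : finType) (adj : rel V) (p : nat) (v : V) : nat :=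
  c2 adj ([set: V] :\ v) p.

(* Main.v *)
Require Import Defs.
From mathcomp Require Import all_boot all_algebra.
From mathcomp Require Import zify ring.
Set Implicit Arguments. Unset Strict Implicit. Unset Printing Implicit Defensive.
Import GRing.Theory Num.Theory.
Local Open Scope ring_scope.

(** It suffices to compare adjacent vertices v and w.  Put H = K - v - w, with N vertices and D = 2N - 3
edges, and let A, B be the three further neighbours of v and of w.  Fixing the variables of the edges
of H, the zeros in the three variables at w number 4 modulo 8, except at the points where all
the relevant tree polynomials vanish.  Hence c_2(K - v) is modulo 2 the number of those
points, and expanding the indicator of this set as a polynomial turns it into the number of
partitions of the edges of H into a spanning tree and a spanning 2-forest whose components separate B.

Group these partitions by the vertex bipartition u given by the 2-forest.  An acyclic edge set is
recognised by the parity of its number of cycle vectors, and an involution cancels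
everything except the u for which the cut of u is itself a spanning tree and both sides
induce trees.  For such u, with S one side, 4-regularity gives 2|S| = |S & A| + |S & B| + N - 3,
so for N odd the difference of the two indicators "u separates A" and "u separates B" is
|S| + |S & A| + (N - 3)/2 modulo 2.  This is linear in u, and each of its terms sums to 0: the number
of such u separating two given vertices is even, and so is the total number when H has a vertex of
degree three.  If H has none, then A = B and there is nothing to prove. *)

(** * Parity sums over F_2 *)

(** Division by 4 asks for the number of zeros modulo 8, which parity alone does not see. With the
    variables of H fixed, the polynomial in the three variables at w is either constant or takes
    both values equally often, so the count is a multiple of 4 with a controlled quotient. The
    indicator (1 + a)(1 + b)(1 + c) has too high a degree to be summed directly. Writing b = f1 + f2
    and c = f1 + f3, the products fi fj vanish at every point after multiplication by 1 + a. What is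
    left are terms of low degree and the products a fi, of degree (N - 2) + (N - 1) = 2N - 3,
    exactly the number of variables; only pairs of complementary monomials contribute, and these are
    the partitions. From there on everything is linear algebra over F_2. Acyclicity and
    connectedness both say that a vector space is trivial, so each indicator is a sum over that
    space; summing over the edge set turns a product of two indicators into a product over the
    edges, and a translation that fixes every factor pairs off the terms. Each indicator of
    separating three vertices is quadratic in u; only the difference is linear. *)

Lemma F2_cases (x : 'F_2) : x = 0 \/ x = 1.
Proof. by case: x => [[|[|//]] i]; [left|right]; apply: val_inj. Qed.

Lemma F2_addrr (x : 'F_2) : x + x = 0.
Proof. by case: (F2_cases x) => ->; apply: val_inj. Qed.

Lemma F2_eq0 (x : 'F_2) : (x == 0)%:R = 1 + x.
Proof. by case: (F2_cases x) => ->; apply: val_inj. Qed.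

Lemma F2_natr (n : nat) : n%:R = (odd n)%:R :> 'F_2.
Proof.
rewrite -{1}(odd_double_half n) natrD -mul2n natrM.
by rewrite (_ : 2%:R = 0 :> 'F_2) ?mul0r ?addr0 //; apply: val_inj.
Qed.

Lemma F2_oppr (x : 'F_2) : - x = x.
Proof. by apply/eqP; rewrite -subr_eq0 -opprD F2_addrr oppr0. Qed.

Lemma F2_ffun_addrr (T : finType) (f : {ffun T -> 'F_2}) : f + f = 0.
Proof. by apply/ffunP => x; rewrite !ffunE F2_addrr. Qed.

(** The map [h] exchanges the classes [phi = 0] and [phi = 1] without changing [f], so both classes
    have the same sum. *)
Lemma F2_sum_shift (T : finType) (f phi : T -> 'F_2) (h : T -> T) :
  injective h -> (forall z, f (h z) = f z) -> (forall z, phi (h z) = phi z + 1) ->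
  \sum_z f z = 0.
Proof.
move=> hI fh phih.
have -> : \sum_z f z = \sum_z f z * phi z + \sum_z f z * (phi z + 1).
  rewrite -big_split; apply: eq_bigr => z _ /=.
  by rewrite mulrDr mulr1 addrA F2_addrr add0r.
rewrite (reindex_inj hI) /=.
under eq_bigr => z _ do rewrite fh phih.
exact: F2_addrr.
Qed.

Lemma forall_natr (R : comPzSemiRingType) (T : finType) (b : pred T) :
  [forall x, b x]%:R = \prod_x (b x)%:R :> R.
Proof.
have [/forallP ball|/forallPn [x nbx]] := boolP [forall x, b x].
  by rewrite big1 // => x _; rewrite ball.
by rewrite (bigD1 x) //= (negbTE nbx) mul0r.
Qed.

(* Writing each indicator as a product over the edges turns the sum over [F] into a product of two-term sums. *)
Lemma sum_complementary (E I J : finType) (P1 : pred I) (P2 : pred J)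
    (f1 : I -> E -> 'F_2) (f2 : J -> E -> 'F_2) (A N : {set E}) :
  [disjoint A & N] ->
  \sum_(F : {set E} | (A \subset F) && (F \subset A :|: N))
    (\sum_(i | P1 i) [forall e, (e \notin F) ==> (f1 i e == 0)]%:R) *
    (\sum_(j | P2 j) [forall e, (e \in F) ==> (f2 j e == 0)]%:R)
  = \sum_(i | P1 i) \sum_(j | P2 j)
      \prod_e (if e \in N then f1 i e + f2 j e
               else if e \in A then 1 + f2 j e else 1 + f1 i e) :> 'F_2.
Proof.
move=> dAN.
under eq_bigr => F _ do rewrite mulr_suml.
rewrite exchange_big; apply: eq_bigr => i _.
under eq_bigr => F _ do rewrite mulr_sumr.
rewrite exchange_big; apply: eq_bigr => j _.
(* [a e] and [b e] are the factors of an edge placed inside and outside [F]; the membership tests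
   encode the bounds [A \subset F] and [F \subset A :|: N]. On [N] the two constants 1 cancel. *)
pose a e : 'F_2 := ((e \in A) || (e \in N))%:R * (1 + f2 j e).
pose b e : 'F_2 := (e \notin A)%:R * (1 + f1 i e).
transitivity (\prod_e (a e + b e)); last first.
  apply: eq_bigr => e _; rewrite /a /b.
  have [eN|eN] := boolP (e \in N).
    rewrite (disjointFl dAN eN) /= !mul1r.
    by rewrite addrACA F2_addrr add0r addrC.
  by case: (e \in A); rewrite /= !(mul1r, mul0r, addr0, add0r).
rewrite bigA_distr big_mkcond; apply: eq_bigr => F _ /=.
have -> : (A \subset F) && (F \subset A :|: N) =
  [forall e, if e \in F then (e \in A) || (e \in N) else e \notin A].
  apply/andP/forallP => [[/subsetP sAF /subsetP sFAN] e|H].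
    case: ifP => eF; first by have := sFAN e eF; rewrite !inE.
    by apply: contraFN eF; apply: sAF.
  split; apply/subsetP => e ein; have := H e; rewrite ein ?inE //.
  by case: (e \in F).
transitivity ([forall e, if e \in F then (e \in A) || (e \in N) else e \notin A]%:R *
  ([forall e, (e \notin F) ==> (f1 i e == 0)]%:R *
   [forall e, (e \in F) ==> (f2 j e == 0)]%:R) : 'F_2).
  by case: ifP => _; rewrite ?mul1r ?mul0r.
rewrite !forall_natr -!big_split; apply: eq_bigr => e _ /=.
by case: ifP => eF; rewrite /= ?mul1r ?mulr1 F2_eq0.
Qed.

(** * Boundary and coboundary *)

(** The nontrivial additive character of ['F_2], with integer values so that solutions are counted
    exactly and not only modulo 2. *)
Definition F2_sign (x : 'F_2) : int := if x == 0 then 1 else -1.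

Lemma F2_signD x y : F2_sign (x + y) = F2_sign x * F2_sign y.
Proof. by case: (F2_cases x) => ->; case: (F2_cases y) => ->. Qed.

Lemma F2_sign_sum (T : finType) (f : T -> 'F_2) :
  F2_sign (\sum_x f x) = \prod_x F2_sign (f x).
Proof. by apply: (big_morph F2_sign) => //; exact: F2_signD. Qed.

Lemma sum_F2 (R : nmodType) (f : 'F_2 -> R) : \sum_c f c = f 0 + f 1.
Proof.
rewrite (bigD1 0) //= (bigD1 1) //= big1 ?addr0 // => c /andP[c0 c1].
by case: (F2_cases c) c0 c1 => ->.
Qed.

Definition within (T : finType) (A : {set T}) (f : {ffun T -> 'F_2}) : bool :=
  [forall x, (x \notin A) ==> (f x == 0)].

Lemma withinP (T : finType) (A : {set T}) (f : {ffun T -> 'F_2}) :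
  reflect (forall x, x \notin A -> f x = 0) (within A f).
Proof.
apply: (iffP forallP) => [H x xA|H x]; first by have := H x; rewrite xA => /eqP.
by apply/implyP => /H ->.
Qed.

Lemma withinD (T : finType) (A : {set T}) (f g : {ffun T -> 'F_2}) :
  within A f -> within A g -> within A (f + g).
Proof.
by move=> /withinP hf /withinP hg; apply/withinP => x xA; rewrite ffunE hf ?hg ?addr0.
Qed.

Lemma within_sub (T : finType) (A B : {set T}) (f : {ffun T -> 'F_2}) :
  A \subset B -> within A f -> within B f.
Proof.
move=> /subsetP sAB /withinP hf; apply/withinP => x xB; apply: hf.
by apply: contra xB; apply: sAB.
Qed.

Lemma within0 (T : finType) (A : {set T}) : within A 0.
Proof. by apply/withinP => x _; rewrite ffunE. Qed.

(** Orthogonality of characters: the sum factors over the coordinates, where one in [A] gives 2 or 0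
    according to [d x], and one outside [A] is fixed to 0 and gives 1. *)
Lemma char_sum (T : finType) (A : {set T}) (d : T -> 'F_2) :
  \sum_(y : {ffun T -> 'F_2} | within A y) F2_sign (\sum_x y x * d x)
  = [forall x in A, d x == 0]%:R * 2 ^+ #|A|.
Proof.
pose G x (c : 'F_2) : int := if x \in A then F2_sign (c * d x) else (c == 0)%:R.
transitivity (\sum_(y : {ffun T -> 'F_2}) \prod_x G x (y x)).
  rewrite big_mkcond; apply: eq_bigr => y _ /=.
  case: ifPn => [/withinP wy|/forallPn [x]].
    rewrite F2_sign_sum; apply: eq_bigr => x _; rewrite /G; case: ifPn => // /wy ->.
    by rewrite mul0r.
  by rewrite negb_imply => /andP[/negbTE xA /negbTE yx]; rewrite (bigD1 x) //= /G xA yx mul0r.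
rewrite -(bigA_distr_bigA G) (bigID (mem A)) /= mulrC big1 ?mul1r; last first.
  by move=> x /negbTE xA; rewrite sum_F2 /G xA.
have [/forallP H|/forallPn [x]] := boolP [forall x in A, d x == 0].
  rewrite mul1r -prodr_const; apply: eq_bigr => x xA.
  have := H x; rewrite xA /= => /eqP dx; by rewrite sum_F2 /G xA dx !mulr0.
rewrite negb_imply => /andP[xA /negbTE dx].
rewrite mul0r (bigD1 x) //= sum_F2 /G xA mul0r mul1r /F2_sign dx eqxx.
by rewrite subrr mul0r.
Qed.

Section Incidence.
Variable V : finType.
Implicit Types (u : {ffun V -> 'F_2}) (y : {ffun {set V} -> 'F_2}).
Implicit Types (S : {set V}) (F : {set {set V}}).

(** Chains are functions on all of [{set V}]; a particular edge set enters only through [within], so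
    subgraphs can be varied without changing types. *)
Definition bd y (x : V) : 'F_2 := \sum_(e : {set V} | x \in e) y e.
Definition cobd u (e : {set V}) : 'F_2 := \sum_(x in e) u x.
Definition is_cycle y : bool := [forall x, bd y x == 0].
(** For edges with two ends these are the functions that are constant on the components of [F]. *)
Definition flat F u : bool := [forall e in F, cobd u e == 0].

Lemma is_cycleP y : reflect (forall x, bd y x = 0) (is_cycle y).
Proof. exact: eqfunP. Qed.

Lemma flatP F u : reflect {in F, forall e, cobd u e = 0} (flat F u).
Proof. exact: eqfun_inP. Qed.

Lemma bdD y z x : bd (y + z) x = bd y x + bd z x.
Proof. by rewrite -big_split; apply: eq_bigr => e _; rewrite ffunE. Qed.

Lemma cobdD u t e : cobd (u + t) e = cobd u e + cobd t e.
Proof. by rewrite -big_split; apply: eq_bigr => x _; rewrite ffunE. Qed.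

Lemma is_cycleD y z : is_cycle y -> is_cycle z -> is_cycle (y + z).
Proof. by move=> /is_cycleP hy /is_cycleP hz; apply/is_cycleP => x; rewrite bdD hy hz addr0. Qed.

Lemma flatD F u t : flat F u -> flat F t -> flat F (u + t).
Proof. by move=> /flatP hu /flatP ht; apply/flatP => e eF; rewrite cobdD hu ?ht ?addr0. Qed.

Lemma bd_adjoint u y : \sum_x u x * bd y x = \sum_e y e * cobd u e.
Proof.
transitivity (\sum_x \sum_(e : {set V} | x \in e) y e * u x).
  by apply: eq_bigr => x _; rewrite mulr_sumr; apply: eq_bigr => e _; rewrite mulrC.
rewrite (exchange_big_dep xpredT) //=; apply: eq_bigr => e _.
by rewrite mulr_sumr.
Qed.

(* Rank-nullity for the incidence matrix: both sides evaluate the sum of [(-1)^<bd y, u>]. *)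
Lemma flat_closed_card S F :
  {in F, forall e : {set V}, e \subset S} ->
  (#|[set u | within S u & flat F u]| * 2 ^ #|F|
   = 2 ^ #|S| * #|[set y | within F y & is_cycle y]|)%N.
Proof.
move=> FS; apply/eqP; rewrite -(eqr_nat int) !natrM !natrX; apply/eqP.
pose W : int := \sum_(u | within S u) \sum_(y | within F y) F2_sign (\sum_e y e * cobd u e).
transitivity W.
  rewrite /W; under eq_bigr => u _ do rewrite char_sum.
  rewrite -mulr_suml -natr_sum; congr (_%:R * _).
  rewrite -[LHS]sum1_card big_mkcond [RHS]big_mkcond; apply: eq_bigr => u _; rewrite inE.
  by case: (within S u) => //=; rewrite /flat; case: ifP => [->|->].
rewrite /W exchange_big /=.
under eq_bigr => y _ do under eq_bigr => u _ do rewrite -bd_adjoint.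
under eq_bigr => y _ do rewrite char_sum.
rewrite -mulr_suml -natr_sum mulrC; congr (_ * _%:R).
rewrite -[RHS]sum1_card big_mkcond [RHS]big_mkcond; apply: eq_bigr => y _; rewrite inE.
case: (boolP (within F y)) => //= /withinP wy.
have -> : is_cycle y = [forall x in S, bd y x == 0]; last by case: [forall x in S, _].
apply/forallP/forallP => H x; first by apply/implyP => _; exact: H.
have := H x; have [//|xS _] := boolP (x \in S).
apply/eqP/big1 => e xe; apply: wy; apply: contra xS => /FS /subsetP; exact.
Qed.

End Incidence.

Lemma F2_ffun_neq0 (T : finType) (f : {ffun T -> 'F_2}) : f != 0 -> exists x, f x = 1.
Proof.
move=> /eqP f0; have [/existsP [x /eqP]|/existsPn H] := boolP [exists x, f x == 1]; first by exists x.
case: f0; apply/ffunP => x; rewrite ffunE.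
by case: (F2_cases (f x)) (H x) => ->.
Qed.

Lemma F2_sum_translate (T : finType) (P : pred {ffun T -> 'F_2}) (k : {ffun T -> 'F_2}) :
  k != 0 -> (forall f, P (f + k) = P f) -> \sum_(f | P f) 1 = 0 :> 'F_2.
Proof.
move=> /F2_ffun_neq0 [x kx] Pk.
rewrite big_mkcond /=.
apply: (@F2_sum_shift {ffun T -> 'F_2} (fun f => if P f then 1 else 0) (fun f => f x) (fun f => f + k)); first exact: addIr.
  by move=> f; rewrite Pk.
by move=> f; rewrite ffunE kx.
Qed.

(** A vector space over ['F_2] has an even number of elements unless it is trivial. *)
Lemma F2_sum_subgroup (T : finType) (P : pred {ffun T -> 'F_2}) :
  P 0 -> (forall f g, P f -> P g -> P (f + g)) ->
  \sum_(f | P f) 1 = [forall f, P f ==> (f == 0)]%:R :> 'F_2.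
Proof.
move=> P0 PD; have [/forallP H|/forallPn [k]] := boolP [forall f, P f ==> (f == 0)].
  rewrite (big_pred1 (0 : {ffun T -> 'F_2})) // => f /=; apply/idP/eqP => [Pf|-> //].
  by have := H f; rewrite Pf => /eqP.
rewrite negb_imply => /andP[Pk k0]; apply: (F2_sum_translate k0) => f.
apply/idP/idP => [Pfk|Pf]; last exact: PD.
by rewrite -[f]addr0 -(F2_ffun_addrr k) addrA PD.
Qed.

Lemma forall_eq0_card (T : finType) (P : pred {ffun T -> 'F_2}) :
  P 0 -> [forall f, P f ==> (f == 0)] = (#|[set f | P f]| == 1)%N.
Proof.
move=> P0; apply/forallP/cards1P => [H|[g Eg] f].
  exists 0; apply/setP => f; rewrite !inE; apply/idP/eqP => [Pf|-> //].
  by have := H f; rewrite Pf => /eqP.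
have /setP E := Eg; have := E 0; rewrite !inE P0 => /esym/eqP g0.
by apply/implyP => Pf; have := E f; rewrite !inE Pf -g0 => /esym.
Qed.

(** * Acyclicity and connectedness by linear algebra *)

Section Trees.
Variable V : finType.
Implicit Types (u : {ffun V -> 'F_2}) (y : {ffun {set V} -> 'F_2}).
Implicit Types (S : {set V}) (F T : {set {set V}}).

Definition acyclic F : bool := [forall y, within F y && is_cycle y ==> (y == 0)].
(* [S] is meant to exclude one root vertex of the graph, so that constant functions are ruled out. *)
Definition connected S F : bool := [forall u, within S u && flat F u ==> (u == 0)].

Lemma acyclicP F :
  reflect (forall y, within F y -> is_cycle y -> y = 0) (acyclic F).
Proof.
apply: (iffP forallP) => [H y wy cy|H y]; first by have := H y; rewrite wy cy => /eqP.
by apply/implyP => /andP[wy cy]; rewrite (H y wy cy).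
Qed.

Lemma connectedP S F :
  reflect (forall u, within S u -> flat F u -> u = 0) (connected S F).
Proof.
apply: (iffP forallP) => [H u wu fu|H u]; first by have := H u; rewrite wu fu => /eqP.
by apply/implyP => /andP[wu fu]; rewrite (H u wu fu).
Qed.

Lemma is_cycle0 : is_cycle (0 : {ffun {set V} -> 'F_2}).
Proof. by apply/is_cycleP => x; apply: big1 => e _; rewrite ffunE. Qed.

Lemma flat0 F : flat F 0.
Proof. by apply/flatP => e _; apply: big1 => x _; rewrite ffunE. Qed.

(** The form needed for summing over edge sets: [within F y] is a conjunction of conditions on
    single edges, so it can be multiplied out by [sum_complementary]. *)
Lemma acyclic_sum F : (acyclic F)%:R = \sum_(y | is_cycle y) (within F y)%:R :> 'F_2.
Proof.
rewrite /acyclic -F2_sum_subgroup ?within0 ?is_cycle0 //.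
  rewrite big_mkcond [RHS]big_mkcond; apply: eq_bigr => y _.
  by case: (is_cycle y); case: (within F y).
by move=> f g /andP[? ?] /andP[? ?]; rewrite withinD ?is_cycleD.
Qed.

Lemma connected_sum S F :
  (connected S F)%:R = \sum_(u | within S u) (flat F u)%:R :> 'F_2.
Proof.
rewrite /connected -F2_sum_subgroup ?within0 ?flat0 //.
  by rewrite big_mkcondr; apply: eq_bigr => u _; case: (flat F u).
by move=> f g /andP[? ?] /andP[? ?]; rewrite withinD ?flatD.
Qed.

Lemma acyclic_subset F T : F \subset T -> acyclic T -> acyclic F.
Proof.
by move=> sFT /acyclicP H; apply/acyclicP => y wy; apply: H; apply: within_sub wy.
Qed.

Definition edges_in S F : Prop := forall e : {set V}, e \in F -> e \subset S /\ #|e| = 2%N.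

Lemma edges_in_subset S F T : F \subset T -> edges_in S T -> edges_in S F.
Proof. by move=> /subsetP sFT ET e /sFT /ET. Qed.

Definition ind S : {ffun V -> 'F_2} := [ffun x => (x \in S)%:R].

Lemma cobd_ind S (e : {set V}) : cobd (ind S) e = #|S :&: e|%:R.
Proof.
rewrite /cobd -sum1_card natr_sum big_mkcond [RHS]big_mkcond; apply: eq_bigr => x _.
by rewrite ffunE !inE; case: (x \in e); case: (x \in S).
Qed.

Lemma flat_ind S F : edges_in S F -> flat F (ind S).
Proof.
move=> EF; apply/flatP => e /EF [eS e2].
by rewrite cobd_ind (setIidPr eS) e2; apply: val_inj.
Qed.

Section Rooted.
Variables (S : {set V}) (r : V) (F : {set {set V}}).
Hypothesis rS : r \in S.
Hypothesis EF : edges_in S F.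

(** The base 2 logarithm of [nflat] is the number of components of [(S, F)] minus one, that of
    [ncycle] is the cycle rank. *)
Definition nflat : nat := #|[set u | within (S :\ r) u & flat F u]|.
Definition ncycle : nat := #|[set y | within F y & is_cycle y]|.

(** Adding the constant function [ind S] exchanges the two possible values at the root. *)
Lemma card_flat_root : #|[set u | within S u & flat F u]| = (2 * nflat)%N.
Proof.
set A := [set u | _]; pose z := ind S.
have zr : z r = 1 by rewrite ffunE rS.
have fz : flat F z := flat_ind EF.
have wz : within S z by apply/withinP => x /negbTE xS; rewrite ffunE xS.
rewrite -(cardsID [set u : {ffun V -> 'F_2} | u r == 0] A) mul2n -addnn; congr (_ + _)%N.
  apply: eq_card => u; rewrite !inE [LHS]andbC !andbA; congr (_ && _).
  apply/andP/withinP => [[/eqP ur /withinP wu] x|wu].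
    by rewrite !inE negb_and negbK => /orP[/eqP->|/wu].
  by split; [rewrite wu ?inE ?eqxx|apply/withinP => x xS; rewrite wu // !inE (negbTE xS) andbF].
rewrite /nflat -[RHS](card_imset _ (@addIr _ z)); apply: eq_card => u.
rewrite !inE. apply/and3P/imsetP => [[ur wu fu]|[t]].
  exists (u + z); last by rewrite -addrA F2_ffun_addrr addr0.
  rewrite inE flatD // andbT; apply/withinP => x; rewrite !inE negb_and negbK.
  move=> /orP[/eqP ->|xS]; last by rewrite (withinP _ _ (withinD wu wz)).
  by rewrite ffunE zr; case: (F2_cases (u r)) ur => -> // _; exact: F2_addrr.
rewrite inE => /andP[wt ft] ->; split; last exact: flatD.
  by rewrite ffunE zr (withinP _ _ wt) // !inE eqxx.
by apply: withinD wz; apply: within_sub wt; apply: subsetDl.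
Qed.

(** Euler's formula, with both sides in the exponent of 2: edges plus components equal vertices plus
    cycle rank. *)
Lemma flat_cycle_card : (nflat * 2 ^ #|F|.+1 = 2 ^ #|S| * ncycle)%N.
Proof.
rewrite expnS mulnA [(nflat * 2)%N]mulnC -card_flat_root flat_closed_card //.
by move=> e /EF[].
Qed.

Lemma acyclicE : acyclic F = (ncycle == 1)%N.
Proof. by rewrite /acyclic forall_eq0_card // within0 is_cycle0. Qed.

Lemma connectedE : connected (S :\ r) F = (nflat == 1)%N.
Proof. by rewrite /connected forall_eq0_card // within0 flat0. Qed.

Lemma nflat_gt0 : (0 < nflat)%N.
Proof. by apply/card_gt0P; exists 0; rewrite inE within0 flat0. Qed.

Lemma ncycle_gt0 : (0 < ncycle)%N.
Proof. by apply/card_gt0P; exists 0; rewrite inE within0 is_cycle0. Qed.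

Lemma acyclic_nflat : acyclic F -> (nflat * 2 ^ #|F|.+1 = 2 ^ #|S|)%N.
Proof. by rewrite acyclicE flat_cycle_card => /eqP ->; rewrite muln1. Qed.

Lemma acyclic_card : acyclic F -> (#|F| < #|S|)%N.
Proof.
move=> /acyclic_nflat E; rewrite -(leq_exp2l (m := 2)) // -E.
by rewrite leq_pmull // nflat_gt0.
Qed.

Lemma connected_card : connected (S :\ r) F -> (#|S| <= #|F|.+1)%N.
Proof.
rewrite connectedE => /eqP n1; rewrite -(leq_exp2l (m := 2)) //.
by have := flat_cycle_card; rewrite n1 mul1n => ->; rewrite leq_pmulr // ncycle_gt0.
Qed.

(** With the edge number of a tree, the powers of 2 in [flat_cycle_card] cancel and leave [nflat]
    equal to [ncycle]. *)
Lemma acyclic_connected : #|F|.+1 = #|S| -> acyclic F = connected (S :\ r) F.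
Proof.
move=> E; rewrite acyclicE connectedE; have := flat_cycle_card; rewrite E mulnC => /eqP.
by rewrite eqn_pmul2l ?expn_gt0 // => /eqP ->.
Qed.

End Rooted.
End Trees.

(** * Spanning trees *)

Section SpanningTrees.
Variables (V : finType) (adj : rel V).
Hypothesis adj_sym : symmetric adj.
Hypothesis adj_irr : irreflexive adj.
Implicit Types (u : {ffun V -> 'F_2}).
Implicit Types (S : {set V}) (F T : {set {set V}}).

Lemma cobd_pair u (a b : V) : a != b -> cobd u [set a; b] = u a + u b.
Proof.
by move=> ab; rewrite /cobd big_setU1 ?big_set1 // inE.
Qed.

Lemma cobd_pair0 u (a b : V) : cobd u [set a; b] = 0 -> u a = u b.
Proof.
have [->//|ab] := eqVneq a b; rewrite cobd_pair // => /eqP.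
by rewrite addr_eq0 F2_oppr => /eqP.
Qed.

Lemma edge_setP S (e : {set V}) :
  reflect (exists x y, [/\ x \in S, y \in S, adj x y & e = [set x; y]]) (e \in edge_set adj S).
Proof.
rewrite inE; apply: (iffP existsP) => [[x /andP[xS /existsP [y /and3P[yS xy /eqP ->]]]]|].
  by exists x, y.
move=> [x [y [xS yS xy ->]]]; exists x; rewrite xS; apply/existsP; exists y.
by rewrite yS xy eqxx.
Qed.

Lemma adj_neq x y : adj x y -> x != y.
Proof. by apply: contraTneq => ->; rewrite adj_irr. Qed.

Lemma edges_in_edge_set S : edges_in S (edge_set adj S).
Proof.
move=> e /edge_setP [x [y [xS yS xy ->]]]; split; last by rewrite cards2 adj_neq.
by apply/subsetP => z; rewrite !inE => /orP[] /eqP ->.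
Qed.

Definition joined F : rel V := fun x y => [set x; y] \in F.

Lemma joined_sym F : symmetric (joined F).
Proof. by move=> x y; rewrite /joined setUC. Qed.

Lemma tadjE S (T : {set edge_t adj S}) :
  tadj T =2 joined [set val e | e in T].
Proof.
move=> x y; rewrite /tadj /joined; apply/existsP/imsetP => [[e /andP[eT /eqP <-]]|[e eT ->]].
  by exists e.
by exists e; rewrite eT eqxx.
Qed.

Lemma flat_connect F u x y : flat F u -> connect (joined F) x y -> u x = u y.
Proof.
move=> /flatP fu /connectP [p]; elim: p x => [|z p IH] x /=; first by move=> _ ->.
by move=> /andP[xz /IH H] /H <-; apply: cobd_pair0; exact: fu.
Qed.

Lemma flat_component F S a :
  edges_in S F -> flat F (ind [set z | connect (joined F) a z]).
Proof.
move=> EF; apply/flatP => e eF; have [_ /eqP/cards2P [x [y [xy Ee]]]] := EF e eF.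
rewrite Ee cobd_pair // !ffunE !inE.
suff -> : connect (joined F) a x = connect (joined F) a y by exact: F2_addrr.
have h : joined F x y by rewrite /joined -Ee.
by apply/idP/idP => H; apply: connect_trans H (connect1 _); rewrite // joined_sym.
Qed.

Lemma sub_connectedE S r (T : {set edge_t adj S}) : r \in S ->
  sub_connected T = connected (S :\ r) [set val e | e in T].
Proof.
move=> rS; set F := [set val e | e in T].
have EF : edges_in S F.
  by apply: edges_in_subset (@edges_in_edge_set S); apply/subsetP => _ /imsetP [e _ ->]; exact: valP.
rewrite /sub_connected; apply/forallP/connectedP => [H u wu fu|H x].
  apply/ffunP => x; rewrite [RHS]ffunE.
  have [xS|xS] := boolP (x \in S); last by rewrite (withinP _ _ wu) // !inE (negbTE xS) andbF.
  have /forallP /(_ x) := implyP (H r) rS; rewrite xS /= (eq_connect (tadjE T)) => rx.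
  by rewrite -(flat_connect fu rx) (withinP _ _ wu) // !inE eqxx.
suff conr x' : x' \in S -> connect (joined F) r x'.
  apply/implyP => xS; apply/forallP => y; apply/implyP => yS.
  rewrite (eq_connect (tadjE T)); apply: connect_trans (conr y yS).
  by rewrite (sym_connect_sym (@joined_sym F)) conr.
(* [u] is the indicator of the part of [S] that is not reached from [r]; it vanishes at [r], so
   connectedness makes it 0. *)
move=> xS; set u := ind [set z | connect (joined F) r z] + ind S.
have fu : flat F u by rewrite flatD ?(flat_component _ EF) ?flat_ind.
have ClS z : connect (joined F) r z -> z \in S.
  move=> /(flat_connect (flat_ind EF)); rewrite !ffunE rS.
  by case: (z \in S) => // /eqP; rewrite oner_eq0.
have /ffunP /(_ x') : u = 0.
  apply: H fu; apply/withinP => z; rewrite !inE negb_and negbK !ffunE inE => /orP[/eqP->|zS].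
    by rewrite connect0 rS F2_addrr.
  by rewrite (negbTE zS) (contraNF (@ClS z) zS) addr0.
by rewrite !ffunE inE xS; case: connect.
Qed.

(** Let [e] join [a] and [b]. If [a] and [b] are joined in [F :\ e], a path closes up to a forbidden
    cycle. Otherwise [e] is the only edge of [F] leaving the component of [a] in [F :\ e], and
    pairing [y] with the indicator of that component gives [y e = 0]. *)
Lemma sub_acyclic_acyclic S (T : {set edge_t adj S}) :
  sub_acyclic T -> acyclic [set val e | e in T].
Proof.
set F := [set val e | e in T] => acT.
have EF : edges_in S F.
  by apply: edges_in_subset (@edges_in_edge_set S); apply/subsetP => _ /imsetP [e _ ->]; exact: valP.
apply/acyclicP => y wy cy; apply/ffunP => e; rewrite [RHS]ffunE.
have [eF|/(withinP _ _ wy) //] := boolP (e \in F).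
have [_ /eqP/cards2P [a [b [ab Ee]]]] := EF e eF.
have EFe : edges_in S (F :\ e) by apply: edges_in_subset EF; apply: subsetDl.
have [/connectP [p0 pp0 lp0]|ncon] := boolP (connect (joined (F :\ e)) a b).
  case/shortenP: pp0 lp0 => p pp up _ lp.
  (* The path is not trivial because [a != b], and it is not the single edge [e] because [e] was
     removed. *)
  have sz : (2 < size (a :: p))%N.
    case: p pp up lp => [|c [|c' p]] //= ; first by move=> _ _ E; rewrite E eqxx in ab.
    by rewrite /joined andbT => Hac _ Ec; rewrite -Ec -Ee !inE eqxx in Hac.
  case/negP: acT; apply/existsP.
  have szV : (size (a :: p) < #|V|.+1)%N by rewrite ltnS; rewrite -(card_uniqP up); apply: max_card.
  exists (Ordinal szV); apply/existsP; exists (in_tuple (a :: p)).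
  rewrite sz up /= rcons_path; apply/andP; split.
    apply: sub_path pp => x z; rewrite tadjE /joined !inE => /andP[] //.
  by rewrite tadjE /joined -lp setUC -Ee.
pose u := ind [set z | connect (joined (F :\ e)) a z].
have := bd_adjoint u y; rewrite big1 => [|x _]; last by rewrite (is_cycleP _ cy) mulr0.
rewrite (bigD1 e) //= big1 ?addr0 => [|f fe].
  by rewrite Ee cobd_pair // !ffunE !inE connect0 (negbTE ncon) addr0 mulr1.
have [fF|/(withinP _ _ wy) ->] := boolP (f \in F); last by rewrite mul0r.
by rewrite (flatP _ _ (flat_component a EFe)) ?mulr0 // !inE fe.
Qed.

(** A path that avoids the end [a] of [e] never uses [e], so flatness on the other edges
    suffices. *)
Lemma flat_path_avoiding F u (e : {set V}) a x p :
  flat (F :\ e) u -> a \in e -> path (joined F) x p -> a \notin x :: p -> u (last x p) = u x.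
Proof.
move=> /flatP fu ae; elim: p x => //= z p IH x /andP[xz pz].
rewrite !inE !negb_or => /and3P[ax az ap].
rewrite IH // ?inE ?negb_or ?az //; apply/esym/cobd_pair0/fu.
rewrite in_setD1 [_ \in F]xz andbT; apply: contraTneq ae => <-.
by rewrite !inE negb_or ax.
Qed.

Lemma sub_acyclic_tree S r (T : {set edge_t adj S}) : r \in S ->
  acyclic [set val e | e in T] -> connected (S :\ r) [set val e | e in T] -> sub_acyclic T.
Proof.
move=> rS; set F := [set val e | e in T] => acF conF.
have EF : edges_in S F.
  by apply: edges_in_subset (@edges_in_edge_set S); apply/subsetP => _ /imsetP [e _ ->]; exact: valP.
apply/existsP => -[k /existsP [[t sz]] /= /andP[/andP[k3 ut] ct]].
move: sz k3 ut ct => /eqP <-; case: t => [|a [|b [|c q]]] // _ ut.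
rewrite (eq_cycle (tadjE T)) /= rcons_path => /andP[jab pbqa].
have /andP[pbq jla] : path (joined F) b (c :: q) && joined F (last b (c :: q)) a.
  by rewrite /= -andbA.
set e := [set last b (c :: q); a].
have eF : e \in F by exact: jla.
have := @connected_card _ S r (F :\ e) rS; have := acyclic_card rS EF acF.
rewrite (cardsD1 e) eF add1n => lt1 /(_ (edges_in_subset (subsetDl _ _) EF)) lt2.
have : connected (S :\ r) (F :\ e); last by move=> /lt2; rewrite leqNgt lt1.
apply/connectedP => u wu fu; apply: (connectedP _ _ conF) => //.
apply/flatP => f fF; have [->|fe] := eqVneq f e; last by apply: (flatP _ _ fu); rewrite !inE fe.
have uab : u a = u b.
  apply: cobd_pair0; apply: (flatP _ _ fu); rewrite !inE [_ \in F]jab andbT.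
  apply/eqP => /setP /(_ b); rewrite !inE eqxx orbT => /esym/orP[/eqP E|/eqP E].
    by move: ut; rewrite /= E (mem_last c q) andbF.
  by move: ut; rewrite E /= !inE eqxx.
have anb : a \notin b :: c :: q by case/andP: ut.
have ulb : u (last b (c :: q)) = u b.
  by apply: (flat_path_avoiding fu) anb => //; rewrite !inE eqxx orbT.
rewrite /e cobd_pair ?ulb ?uab ?F2_addrr //.
by apply: contraNneq anb => <-; exact: mem_last.
Qed.

Lemma spanning_treeE S r (T : {set edge_t adj S}) : r \in S ->
  spanning_tree T =
  acyclic [set val e | e in T] && connected (S :\ r) [set val e | e in T].
Proof.
move=> rS; rewrite /spanning_tree (sub_connectedE T rS) andbC.
have [conT|] := boolP (connected _ _); rewrite ?andbF ?andbT //.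
by apply/idP/idP => [/sub_acyclic_acyclic|/(sub_acyclic_tree rS)]; last exact.
Qed.

End SpanningTrees.

(** * The point count *)

Lemma big_powersetU1 (R : nmodType) (T : finType) (e : T) (P : {set T}) (f : {set T} -> R) :
  e \notin P ->
  \sum_(A in powerset (e |: P)) f A = \sum_(A in powerset P) (f A + f (e |: A)).
Proof.
move=> eP; rewrite big_split /= (bigID (fun A : {set T} => e \notin A)) /=; congr (_ + _).
  by apply: eq_bigl => A; rewrite !powersetE -subsetD1 setU1K.
rewrite (reindex_onto (fun A => e |: A) (fun A => A :\ e)) /=; last first.
  by move=> A /andP[_]; rewrite negbK; exact: setD1K.
apply: eq_bigl => A; rewrite !powersetE setU11 andbT.
apply/andP/idP => [[sAP /eqP <-]|sAP].
  by rewrite -(setU1K eP) setSD.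
by rewrite setUS // setU1K //; apply: contra eP; apply: (subsetP sAP).
Qed.

(** The monomial with missing variables [F] equals 1 at [2 ^ #|F|] points, an odd number only if no
    variable is missing. *)
Lemma sum_supersets (T : finType) (D F : {set T}) : F \subset D ->
  \sum_(X in powerset D) (D :\: F \subset X)%:R = (F == set0)%:R :> 'F_2.
Proof.
move=> sFD; have [->|[e eF]] := set_0Vmem F.
  rewrite setD0 eqxx (bigD1 D) ?powersetE //= subxx big1 ?addr0 // => X.
  by rewrite powersetE eqEsubset => /andP[-> /=] /negbTE ->.
have -> : (F == set0) = false by apply/negbTE/set0Pn; exists e.
rewrite -(setD1K (subsetP sFD e eF)) big_powersetU1 ?setD11 // big1 // => X _.
rewrite setD1K ?(subsetP sFD) //.
have -> : (D :\: F \subset e |: X) = (D :\: F \subset X); last exact: F2_addrr.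
apply/subsetP/subsetP => H f fDF; have := H f fDF; rewrite !inE; last by move=> ->; rewrite orbT.
by case/orP => // /eqP Ef; move: fDF; rewrite Ef !inE eF.
Qed.

Section Count.
Variables (V : finType) (adj : rel V).
Hypothesis adj_irr : irreflexive adj.

(** The Kirchhoff polynomial at the point over ['F_2] with support [X]: the monomial of [T] is 1
    exactly if [X] contains the complement of [T]. The set [S] already lacks its root. *)
Definition tree_sum (S : {set V}) (E : {set {set V}}) (X : {set {set V}}) : 'F_2 :=
  \sum_(T in powerset E) (acyclic T && connected S T && (E :\: T \subset X))%:R.

Variables (S : {set V}) (r : V).
Hypothesis rS : r \in S.

Definition edge_supp (a : {ffun edge_t adj S -> 'F_2}) : {set {set V}} :=
  [set val e | e in [set e | a e != 0]].

Lemma edges_of_sets (A : {set {set V}}) :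
  A \subset edge_set adj S -> exists T : {set edge_t adj S}, A = [set val e | e in T].
Proof.
move=> /subsetP sAE; exists [set e | val e \in A]; apply/setP => e.
apply/idP/imsetP => [eA|[f]]; last by rewrite inE => ? ->.
by exists (Sub e (sAE e eA)); rewrite ?inE SubK.
Qed.

Lemma powerset_edges :
  powerset (edge_set adj S) = [set [set val e | e in T] | T : {set edge_t adj S}].
Proof.
apply/setP => A; rewrite powersetE; apply/idP/imsetP => [/edges_of_sets [T ->]|[T _ ->]].
  by exists T.
by apply/subsetP => _ /imsetP [e _ ->]; exact: valP.
Qed.

Lemma kirchhoff_evalE (a : {ffun edge_t adj S -> 'F_2}) :
  kirchhoff_eval a = tree_sum (S :\ r) (edge_set adj S) (edge_supp a).
Proof.
rewrite /tree_sum powerset_edges big_imset /=; last by move=> T T' _ _; move=> E; apply: (imset_inj val_inj) E.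
rewrite /kirchhoff_eval big_mkcond [RHS]big_mkcond; apply: eq_bigr => T _ /=.
rewrite (spanning_treeE adj_irr T rS); case: (_ && _) => //=.
have -> : (edge_set adj S :\: [set val e | e in T] \subset edge_supp a)
   = [forall e, (e \notin T) ==> (a e != 0)].
  apply/subsetP/forallP => [H e|H e].
    apply/implyP => eT; have /imsetP [f] : val e \in edge_supp a.
      by apply: H; rewrite inE (valP e) andbT (mem_imset _ _ val_inj).
    by rewrite inE => af /val_inj ->.
  rewrite inE => /andP[eT eE]; pose f : edge_t adj S := Sub e eE.
  apply/imsetP; exists f; rewrite ?SubK // inE; apply: (implyP (H f)).
  by apply: contra eT => fT; apply/imsetP; exists f; rewrite ?SubK.
rewrite forall_natr big_mkcond; apply: eq_bigr => e _; rewrite inE.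
by case: (e \in T) => //=; case: (F2_cases (a e)) => ->.
Qed.

Lemma edge_supp_inj : injective edge_supp.
Proof.
move=> a b /setP E; apply/ffunP => e.
have := E (val e); rewrite !(mem_imset _ _ val_inj) !inE.
by case: (F2_cases (a e)) => ->; case: (F2_cases (b e)) => ->.
Qed.

Lemma edge_supp_surj (A : {set {set V}}) :
  A \subset edge_set adj S -> exists a, edge_supp a = A.
Proof.
move=> /edges_of_sets [T ->]; exists [ffun e => (e \in T)%:R].
rewrite /edge_supp; suff -> : [set e | [ffun e => (e \in T)%:R : 'F_2] e != 0] = T by [].
by apply/setP => e; rewrite inE ffunE; case: (e \in T).
Qed.

Lemma psi_countE :
  psi_count adj S 2 =
  (\sum_(X in powerset (edge_set adj S))
     (tree_sum (S :\ r) (edge_set adj S) X == 0%R))%N.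
Proof.
rewrite /psi_count -(card_imset _ edge_supp_inj) -sum1_card big_mkcond [RHS]big_mkcond.
apply: eq_bigr => X _; rewrite powersetE.
have [/edge_supp_surj [a <-]|nX] := boolP (X \subset _).
  by rewrite (mem_imset _ _ edge_supp_inj) inE kirchhoff_evalE; case: eqP.
case: imsetP => // -[a _ EX]; case/negP: nX; rewrite EX.
by apply/subsetP => _ /imsetP [e _ ->]; exact: valP.
Qed.

End Count.

(** * Affine systems *)

Lemma F2_closed_translate (T : finType) (P : pred {ffun T -> 'F_2}) (k : {ffun T -> 'F_2}) :
  (forall f g, P f -> P g -> P (f + g)) -> P k -> forall f, P (f + k) = P f.
Proof.
move=> PD Pk f; apply/idP/idP => [Pfk|Pf]; last exact: PD.
by rewrite -[f]addr0 -(F2_ffun_addrr k) addrA PD.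
Qed.

Lemma F2_sum2_translate (T1 T2 : finType) (P1 : pred {ffun T1 -> 'F_2})
    (P2 : pred {ffun T2 -> 'F_2}) (k1 : {ffun T1 -> 'F_2}) (k2 : {ffun T2 -> 'F_2})
    (W : {ffun T1 -> 'F_2} -> {ffun T2 -> 'F_2} -> 'F_2) :
  (k1 != 0) || (k2 != 0) ->
  (forall f, P1 (f + k1) = P1 f) -> (forall g, P2 (g + k2) = P2 g) ->
  (forall f g, W (f + k1) (g + k2) = W f g) ->
  \sum_(f | P1 f) \sum_(g | P2 g) W f g = 0.
Proof.
move=> k12 Pk1 Pk2 Wk; rewrite pair_big big_mkcond /=.
pose h (p : {ffun T1 -> 'F_2} * {ffun T2 -> 'F_2}) := (p.1 + k1, p.2 + k2).
pose f (p : {ffun T1 -> 'F_2} * {ffun T2 -> 'F_2}) := if P1 p.1 && P2 p.2 then W p.1 p.2 else 0.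
have fh p : f (h p) = f p by rewrite /f /= Pk1 Pk2 Wk.
have hI : injective h by move=> [a b] [c d] [/addIr -> /addIr ->].
have [/F2_ffun_neq0 [x kx]|/F2_ffun_neq0 [x kx]] := orP k12.
  by apply: (@F2_sum_shift _ f (fun p => p.1 x) h) => // p; rewrite ffunE kx.
by apply: (@F2_sum_shift _ f (fun p => p.2 x) h) => // p; rewrite ffunE kx.
Qed.

Section Theta.
Variables (V : finType) (H : {set V}) (D : {set {set V}}).
Implicit Types (u l : {ffun V -> 'F_2}) (y k : {ffun {set V} -> 'F_2}) (X J F : {set {set V}}).

(** Acyclicity and connectedness are tested after adding different sets [J1] and [J2], as happens
    when the same forest has to be completed to a tree in two ways. *)
Definition theta J1 J2 X : 'F_2 :=
  \sum_(F in powerset D)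
    ((D :\: F \subset X) && (acyclic (J1 :|: F) && connected H (J2 :|: F)))%:R.

Definition chain_space J1 : pred {ffun {set V} -> 'F_2} :=
  fun y => is_cycle y && within (J1 :|: D) y.
Definition vertex_space J2 : pred {ffun V -> 'F_2} :=
  fun u => within H u && flat J2 u.

(** An affine system for a chain and a vertex function; [homogeneous] is its linear part, as signs
    do not matter over ['F_2]. *)
Definition solution X y u : bool :=
  [forall e in D, if e \in X then y e + cobd u e == 1 else cobd u e == 0].
Definition homogeneous X k l : bool :=
  [forall e in D, if e \in X then k e == cobd l e else cobd l e == 0].

Lemma homogeneousD X y u y' u' :
  solution X y u -> solution X y' u' -> homogeneous X (y + y') (u + u').
Proof.
move=> /forall_inP s1 /forall_inP s2; apply/forall_inP => e eD.
have := s1 e eD; have := s2 e eD; rewrite cobdD ffunE; case: ifP => _ /eqP E1 /eqP E2; last first.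
  by rewrite E1 E2 addr0.
by rewrite -subr_eq0 F2_oppr addrACA E1 E2 F2_addrr.
Qed.

Lemma solutionD X y u k l : homogeneous X k l -> solution X (y + k) (u + l) = solution X y u.
Proof.
move=> /forall_inP hk; apply: eq_forallb => e; case: (boolP (e \in D)) => //= eD.
have := hk e eD; rewrite cobdD ffunE; case: ifP => _ /eqP E1; last by rewrite E1 addr0.
by rewrite E1 addrACA F2_addrr addr0.
Qed.

(** The summation range says that [F] contains [D :\: X] and is free on [X]. Once both indicators
    are expanded, the sum over [F] leaves one factor per edge, and each factor is the indicator of
    one equation of the system. *)
Lemma thetaE J1 J2 X : X \subset D -> [disjoint J1 & D] ->
  theta J1 J2 X = \sum_(y | chain_space J1 y) \sum_(u | vertex_space J2 u) (solution X y u)%:R.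
Proof.
move=> sXD dJD.
have disA : [disjoint D :\: X & X].
  by rewrite -setI_eq0 setIDAC; apply/eqP/setP => e; rewrite !inE; case: (e \in X); rewrite ?andbF.
have UX : D :\: X :|: X = D.
  by apply/setP => e; rewrite !inE; case: (boolP (e \in X)) => [/(subsetP sXD) ->|_] //=; rewrite orbF.
pose f1 (y : {ffun {set V} -> 'F_2}) e : 'F_2 := (e \in D)%:R * y e.
pose f2 (u : {ffun V -> 'F_2}) e : 'F_2 := cobd u e.
transitivity (\sum_(F : {set {set V}} | (D :\: X \subset F) && (F \subset D :\: X :|: X))
    (\sum_(y | chain_space J1 y) [forall e, (e \notin F) ==> (f1 y e == 0)]%:R) *
    (\sum_(u | vertex_space J2 u) [forall e, (e \in F) ==> (f2 u e == 0)]%:R) : 'F_2).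
  rewrite UX /theta big_mkcond [RHS]big_mkcond; apply: eq_bigr => F _.
  rewrite powersetE; have [sFD|_] := boolP (F \subset D); last by rewrite andbF.
  have -> : (D :\: F \subset X) = (D :\: X \subset F) by rewrite !subDset setUC.
  case: (D :\: X \subset F) => //.
  rewrite [true && _]/= -mulnb natrM; congr (_ * _).
    rewrite acyclic_sum big_mkcond [RHS]big_mkcond; apply: eq_bigr => y _.
    rewrite /chain_space; case: (is_cycle y) => //=.
    have -> : within (J1 :|: F) y = within (J1 :|: D) y && [forall e, (e \notin F) ==> (f1 y e == 0)].
      apply/withinP/andP => [wy|[/withinP wy /forallP HF] e].
        split; first by apply/withinP => e; rewrite inE => /norP[eJ eD]; apply: wy; rewrite inE (negbTE eJ) (contra _ eD) //; exact: (subsetP sFD).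
        apply/forallP => e; apply/implyP => eF; rewrite /f1; have [eD|_] := boolP (e \in D); last by rewrite mul0r.
        by rewrite mul1r wy // inE negb_or eF (disjointFl dJD eD).
      rewrite inE => /norP[eJ eF]; have := HF e; rewrite eF /f1 /=.
      have [eD|eD] := boolP (e \in D); first by rewrite mul1r => /eqP.
      by move=> _; apply: wy; rewrite inE negb_or eJ.
    by case: within.
  rewrite connected_sum big_mkcond [RHS]big_mkcond; apply: eq_bigr => u _.
  rewrite /vertex_space; case: (within H u) => //=.
  have -> : flat (J2 :|: F) u = flat J2 u && [forall e, (e \in F) ==> (f2 u e == 0)].
    apply/flatP/andP => [fu|[/flatP fu /forall_inP gu] e].
      by split; [apply/flatP|apply/forall_inP] => e eJ; rewrite /f2 fu // inE eJ ?orbT.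
    by rewrite inE => /orP[/fu //|/gu /eqP].
  by case: (flat J2 u).
rewrite sum_complementary //; apply: eq_bigr => y _; apply: eq_bigr => u _.
rewrite forall_natr; apply: eq_bigr => e _; rewrite /f1 /f2 inE.
have [eX|eX] := boolP (e \in X).
  rewrite (subsetP sXD e eX) mul1r.
  by case: (F2_cases (y e)) => ->; case: (F2_cases (cobd u e)) => ->; apply: val_inj.
by case: (e \in D); rewrite /= ?mul0r ?addr0 // F2_eq0.
Qed.

Lemma chain_spaceD J y k : chain_space J y -> chain_space J k -> chain_space J (y + k).
Proof. by move=> /andP[? ?] /andP[? ?]; rewrite /chain_space is_cycleD ?withinD. Qed.

Lemma vertex_spaceD J u l : vertex_space J u -> vertex_space J l -> vertex_space J (u + l).
Proof. by move=> /andP[? ?] /andP[? ?]; rewrite /vertex_space flatD ?withinD. Qed.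

(** The solutions of an affine system over ['F_2] are either absent or a translate of the
    homogeneous ones, so an odd number of them means exactly one. *)
Lemma theta_neq0 J1 J2 X : X \subset D -> [disjoint J1 & D] -> theta J1 J2 X != 0 ->
  (exists y u, [/\ chain_space J1 y, vertex_space J2 u & solution X y u]) /\
  (forall k l, chain_space J1 k -> vertex_space J2 l -> homogeneous X k l -> k = 0 /\ l = 0).
Proof.
move=> sXD dJD; rewrite thetaE // => nz.
split.
  rewrite pair_big /= in nz; have [/existsP [p /and3P[]]|/existsPn Hn] := boolP [exists p : {ffun {set V} -> 'F_2} * {ffun V -> 'F_2},
    [&& chain_space J1 p.1, vertex_space J2 p.2 & solution X p.1 p.2]].
    by exists p.1, p.2.
  case/eqP: nz; apply: big1 => p /andP[c1 c2].
  by have := Hn p; rewrite c1 c2 /= => /negbTE ->.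
move=> k l ck vl hkl; suff /andP[/eqP -> /eqP ->] : (k == 0) && (l == 0) by [].
apply: contraNT nz; rewrite negb_and => kl; apply/eqP.
apply: (F2_sum2_translate kl).
- by apply: F2_closed_translate => //; exact: chain_spaceD.
- by apply: F2_closed_translate => //; exact: vertex_spaceD.
by move=> f g; rewrite (solutionD _ _ hkl).
Qed.

Lemma theta_eq1 J1 J2 X y u : X \subset D -> [disjoint J1 & D] ->
  chain_space J1 y -> vertex_space J2 u -> solution X y u ->
  (forall k l, chain_space J1 k -> vertex_space J2 l -> homogeneous X k l -> k = 0 /\ l = 0) ->
  theta J1 J2 X = 1.
Proof.
move=> sXD dJD cy vu sol hom; rewrite thetaE // pair_big /= (bigD1 (y, u)) /= ?cy // sol.
rewrite big1 ?addr0 // => -[y' u'] /= /andP[/andP[cy' vu'] ne].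
have [sol'|//] := boolP (solution X y' u').
have [] := hom _ _ (chain_spaceD cy' cy) (vertex_spaceD vu' vu) (homogeneousD sol' sol).
move=> /eqP; rewrite addr_eq0 => /eqP Ey /eqP; rewrite addr_eq0 => /eqP Eu.
case/negP: ne; rewrite xpair_eqE; apply/andP; split; apply/eqP/ffunP => x.
  by rewrite Ey ffunE F2_oppr.
by rewrite Eu ffunE F2_oppr.
Qed.

End Theta.

(** * Adding a vertex of degree three *)

Section Star.
Variables (V : finType) (H : {set V}) (D : {set {set V}}) (w : V).
Hypothesis wH : w \notin H.
Hypothesis ED : edges_in H D.
Implicit Types (u l : {ffun V -> 'F_2}) (y k : {ffun {set V} -> 'F_2}) (X J F : {set {set V}}).

Definition spoke (b : V) : {set V} := [set w; b].
(** The root is the added vertex [w], so the set [H] passed to [connected] is the vertex set without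
    its root. *)
Definition is_tree (T : {set {set V}}) : bool := acyclic T && connected H T.

Lemma spokeD b : spoke b \notin D.
Proof.
apply/negP => /ED [/subsetP sb _]; case/negP: wH; apply: sb; by rewrite !inE eqxx.
Qed.

Lemma H_neq_w b : b \in H -> w != b.
Proof. by apply: contraTneq => <-. Qed.

Lemma spoke_eq b c : b \in H -> c \in H -> (spoke b == spoke c) = (b == c).
Proof.
move=> bH cH; apply/eqP/eqP => [/setP /(_ b)|-> //].
by rewrite !inE eqxx orbT [b == w]eq_sym (negbTE (H_neq_w bH)) => /esym/eqP.
Qed.

Lemma spokes_disjoint b c : [disjoint [set spoke b; spoke c] & D].
Proof.
by rewrite -setI_eq0; apply/eqP/setP => e; rewrite !inE; apply/negP => /andP[/orP[] /eqP ->]; apply/negP/spokeD.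
Qed.

Lemma cobd_spoke u b : within H u -> b \in H -> cobd u (spoke b) = u b.
Proof.
by move=> /withinP wu bH; rewrite cobd_pair ?H_neq_w // wu // add0r.
Qed.

Lemma edges_in_spoke F b : b \in H -> edges_in (w |: H) F -> edges_in (w |: H) (spoke b |: F).
Proof.
move=> bH EF e /setU1P [->|/EF //]; split; last by rewrite cards2 H_neq_w.
by apply/subsetP => x; rewrite !inE => /orP[/eqP->|/eqP->]; rewrite ?eqxx ?bH ?orbT.
Qed.

Lemma edges_in_widen F : F \subset D -> edges_in (w |: H) F.
Proof.
move=> sFD e eF; have [eH e2] := ED (subsetP sFD e eF); split => //.
by apply: subset_trans eH _; apply: subsetUr.
Qed.

Lemma widenD1 : (w |: H) :\ w = H.
Proof. by rewrite setU1K. Qed.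

Lemma widen_card : #|w |: H| = #|H|.+1.
Proof. by rewrite cardsU1 wH. Qed.

Lemma is_tree_connected T : edges_in (w |: H) T -> is_tree T = (#|T| == #|H|) && connected H T.
Proof.
move=> ET; have wS : w \in w |: H by rewrite !inE eqxx.
rewrite /is_tree; case: (boolP (connected H T)) => cT; rewrite ?andbF // !andbT.
have := connected_card wS ET; rewrite widenD1 widen_card ltnS => /(_ cT) le1.
apply/idP/eqP => [/(acyclic_card wS ET)|E].
  by rewrite widen_card ltnS => le2; apply/eqP; rewrite eqn_leq le2.
by rewrite (acyclic_connected wS ET) ?widenD1 // widen_card E.
Qed.

Lemma is_tree_acyclic T : edges_in (w |: H) T -> is_tree T = (#|T| == #|H|) && acyclic T.
Proof.
move=> ET; have wS : w \in w |: H by rewrite !inE eqxx.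
rewrite /is_tree; case: (boolP (acyclic T)) => aT; rewrite ?andbF // !andbT /=.
have := acyclic_card wS ET aT; rewrite widen_card ltnS => le1.
apply/idP/eqP => [|E].
  move=> cT; have := connected_card wS ET; rewrite widenD1 widen_card ltnS => /(_ cT) le2.
  by apply/eqP; rewrite eqn_leq le1.
have := acyclic_connected wS ET; rewrite widen_card E widenD1 => /(_ erefl) <-.
exact: aT.
Qed.

Lemma flatU1 F e u : flat (e |: F) u = (cobd u e == 0) && flat F u.
Proof.
apply/flatP/andP => [H1|[/eqP ue /flatP fu] f /setU1P [->|]] //; last exact: fu.
split; first by apply/eqP/H1; rewrite !inE eqxx.
by apply/flatP => f fF; apply: H1; rewrite inE fF orbT.
Qed.

Lemma indH b : b \in H -> ind H b = 1.
Proof. by move=> bH; rewrite ffunE bH. Qed.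

Lemma within_ind : within H (ind H).
Proof. by apply/withinP => x /negbTE xH; rewrite ffunE xH. Qed.

Lemma flat_indD F : F \subset D -> flat F (ind H).
Proof. by move=> sFD; apply: flat_ind => e eF; apply: ED; apply: (subsetP sFD). Qed.

Hypothesis H_neq0 : H != set0.

Lemma indH_neq0 : ind H != 0.
Proof.
have /set0Pn [x xH] := H_neq0; apply/eqP => /ffunP /(_ x).
by rewrite ffunE xH ffunE => /eqP; rewrite oner_eq0.
Qed.

Lemma is_tree_no_spoke F : F \subset D -> is_tree F = false.
Proof.
move=> sFD; apply/negbTE/negP => /andP[_ /connectedP c].
by have /eqP := indH_neq0; apply; apply: c (within_ind) (flat_indD sFD).
Qed.

(** Functions flat on [F] can be shifted by the constant [ind H], so vanishing at [b] and vanishing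
    at [c] are equally strong normalizations. *)
Lemma connected_spoke_indep F b c : F \subset D -> b \in H -> c \in H ->
  connected H (spoke b |: F) -> connected H (spoke c |: F).
Proof.
move=> sFD bH cH /connectedP con; apply/connectedP => u wu.
rewrite flatU1 cobd_spoke // => /andP[/eqP uc fu].
have [ub|ub] := F2_cases (u b).
  by apply: con; rewrite // flatU1 cobd_spoke // ub eqxx.
have E : u + ind H = 0.
  apply: con; first by rewrite withinD ?within_ind.
  by rewrite flatU1 flatD ?flat_indD // cobd_spoke ?withinD ?within_ind // ffunE ub indH.
have := congr1 (fun f : {ffun V -> 'F_2} => f c) E.
by rewrite !ffunE uc cH add0r => /eqP; rewrite oner_eq0.
Qed.

Lemma is_tree_spoke_indep F b c : F \subset D -> b \in H -> c \in H ->
  is_tree (spoke b |: F) = is_tree (spoke c |: F).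
Proof.
move=> sFD bH cH; have EF := edges_in_widen sFD.
rewrite !is_tree_connected; try exact: edges_in_spoke.
have nF x : spoke x \notin F by apply: contra (spokeD x); apply: (subsetP sFD).
rewrite !cardsU1 !nF; congr (_ && _).
by apply/idP/idP; apply: connected_spoke_indep.
Qed.

Section ThreeSpokes.
Variables x y z : V.
Hypotheses (xH : x \in H) (yH : y \in H) (zH : z \in H).
Hypotheses (xy : x != y) (xz : x != z) (yz : y != z).

Lemma card_spokes2 F a b : F \subset D -> a \in H -> b \in H -> a != b ->
  #|spoke a |: (spoke b |: F)| = #|F|.+2.
Proof.
move=> sFD aH bH ab; have nF t : spoke t \notin F by apply: contra (spokeD t); apply: (subsetP sFD).
by rewrite !cardsU1 !inE negb_or spoke_eq // ab !nF.
Qed.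

Lemma edges_in_spokes2 F a b : F \subset D -> a \in H -> b \in H ->
  edges_in (w |: H) (spoke a |: (spoke b |: F)).
Proof. by move=> sFD aH bH; do 2!apply: edges_in_spoke => //; exact: edges_in_widen. Qed.

Lemma flat_spokes2 F a b u : a \in H -> b \in H -> within H u ->
  flat (spoke a |: (spoke b |: F)) u = [&& u a == 0, u b == 0 & flat F u].
Proof. by move=> aH bH wu; rewrite !flatU1 !cobd_spoke. Qed.

(* Removing the two spokes leaves two components; the third end lies in exactly one of them. *)
Lemma is_tree_spokes_split F : F \subset D ->
  is_tree (spoke x |: (spoke y |: F)) ->
  is_tree (spoke x |: (spoke z |: F)) = ~~ is_tree (spoke y |: (spoke z |: F)).
Proof.
move=> sFD; rewrite !is_tree_connected; try exact: edges_in_spokes2.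
rewrite !card_spokes2 // => /andP[cF /connectedP con]; rewrite cF /=.
(* [F] has two edges fewer than [H] has vertices, hence is disconnected; [u0] will turn out to be
   the indicator of the component without [x]. *)
have [u0 [wu0 fu0 u0x /eqP u00]] : exists u0, [/\ within H u0, flat F u0, u0 x = 0 & u0 != 0].
  have ncon : ~~ connected (H :\ x) F.
    apply/negP => /(@connected_card _ _ _ _ xH); move/eqP: cF => <-.
    by rewrite ltnn => /(_ (edges_in_subset sFD ED)).
  have /forallPn [u] := ncon; rewrite negb_imply => /andP[/andP[wu fu] un].
  exists u; split => //; first by apply: within_sub wu; apply: subsetDl.
  by apply: (withinP _ _ wu); rewrite !inE eqxx.
have u0y : u0 y = 1.
  have [E|//] := F2_cases (u0 y); case: u00; apply: con => //.
  by rewrite flat_spokes2 // u0x E fu0.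
have un t : within H t -> flat F t -> t x = 0 -> t y = 0 -> t = 0.
  by move=> wt ft tx ty; apply: con; rewrite // flat_spokes2 // tx ty ft.
have f1 := flat_indD sFD; have w1 := within_ind.
have cxz : connected H (spoke x |: (spoke z |: F)) = (u0 z == 1).
  apply/connectedP/eqP => [c|u0z t wt].
    have [E|//] := F2_cases (u0 z); case: u00; apply: c => //.
    by rewrite flat_spokes2 // u0x E fu0.
  rewrite flat_spokes2 // => /and3P[/eqP tx /eqP tz ft].
  have [ty|ty] := F2_cases (t y); first exact: un.
  have E : t + u0 = 0 by apply: un; rewrite ?withinD ?flatD // ffunE ?tx ?u0x ?ty ?u0y ?F2_addrr ?addr0.
  have := congr1 (fun f : {ffun V -> 'F_2} => f z) E.
  by rewrite !ffunE tz u0z add0r => /eqP; rewrite oner_eq0.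
have cyz : connected H (spoke y |: (spoke z |: F)) = (u0 z == 0).
  have E1 : u0 + ind H != 0.
    apply/eqP => /ffunP /(_ x); rewrite !ffunE u0x xH => /eqP; by rewrite add0r oner_eq0.
  apply/connectedP/eqP => [c|u0z t wt].
    have [//|E] := F2_cases (u0 z); case/eqP: E1; apply: c; first exact: withinD.
    by rewrite flat_spokes2 ?withinD // !ffunE u0y E yH zH flatD // F2_addrr eqxx.
  rewrite flat_spokes2 // => /and3P[/eqP ty /eqP tz ft].
  have [tx|tx] := F2_cases (t x); first exact: un.
  have E : t + (u0 + ind H) = 0.
    apply: un; rewrite ?withinD ?flatD // !ffunE ?tx ?ty ?u0x ?u0y ?xH ?yH.
      by rewrite add0r F2_addrr.
    by rewrite add0r F2_addrr.
  have := congr1 (fun f : {ffun V -> 'F_2} => f z) E.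
  by rewrite !ffunE tz u0z zH !add0r => /eqP; rewrite oner_eq0.
by rewrite cxz cyz; case: (F2_cases (u0 z)) => ->.
Qed.

End ThreeSpokes.

(** Both edge sets have the same size. Acyclicity of one bounds it above and connectedness of the
    other bounds it below, so the size is that of a tree and each set needs only one of the two
    tests. This brings the condition into the shape of [theta]. *)
Lemma is_tree_two_ways F (x y z : V) : F \subset D ->
  x \in H -> y \in H -> z \in H -> x != y -> x != z ->
  is_tree (spoke x |: (spoke y |: F)) && is_tree (spoke x |: (spoke z |: F)) =
  acyclic ([set spoke x; spoke y] :|: F) && connected H ([set spoke x; spoke z] :|: F).
Proof.
move=> sFD xH yH zH xy xz; rewrite -!setUA.
have Ey := edges_in_spokes2 sFD xH yH; have Ez := edges_in_spokes2 sFD xH zH.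
rewrite is_tree_acyclic // [X in _ && X]is_tree_connected // !card_spokes2 //.
case: (boolP (acyclic _)) => aT; rewrite ?andbF //= andbT andbA andbb.
case: (boolP (connected _ _)) => cT; rewrite ?andbF //= andbT.
have wS : w \in w |: H by rewrite !inE eqxx.
have := acyclic_card wS Ey aT; have := connected_card wS Ez; rewrite widenD1 => /(_ cT).
rewrite widen_card !card_spokes2 // !ltnS => l1 l2.
by rewrite eqn_leq l1 l2.
Qed.

End Star.

(** * A pointwise relation between the tree polynomials at three spokes *)

Section Pointwise.
Variables (V : finType) (H : {set V}) (D : {set {set V}}) (w : V).
Hypothesis wH : w \notin H.
Hypothesis ED : edges_in H D.
Variables x y z : V.
Hypotheses (xH : x \in H) (yH : y \in H) (zH : z \in H).
Hypotheses (xy : x != y) (xz : x != z) (yz : y != z).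
Implicit Types (c k : {ffun {set V} -> 'F_2}) (u l : {ffun V -> 'F_2}).
Local Notation sx := (spoke w x).
Local Notation sy := (spoke w y).
Local Notation sz := (spoke w z).

Lemma bd_hub c : within ([set sx; sy; sz] :|: D) c -> bd c w = c sx + c sy + c sz.
Proof.
move=> /withinP wc.
have wsp b : w \in spoke w b by rewrite !inE eqxx.
have nyx : sy != sx by rewrite (spoke_eq wH) // eq_sym.
have nzx : sz != sx by rewrite (spoke_eq wH) // eq_sym.
have nzy : sz != sy by rewrite (spoke_eq wH) // eq_sym.
rewrite /bd (bigD1 sx) ?wsp //= (bigD1 sy) /= ?wsp ?nyx //.
rewrite (bigD1 sz) /= ?wsp ?nzx ?nzy // big1 ?addr0 ?addrA // => e.
move=> /andP[/andP[/andP[we e1] e2] e3]; apply: wc; rewrite !inE !negb_or e1 e2 e3 /=.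
by apply: contra wH => /ED[/subsetP eH _]; apply: eH.
Qed.

Lemma spoke_notin b : spoke w b \notin D.
Proof. exact: (spokeD wH ED). Qed.

Lemma within_drop (J : {set {set V}}) c :
  within (J :|: D) c -> {in J, forall e, c e = 0} -> within D c.
Proof.
move=> /withinP wc cJ; apply/withinP => e eD.
by have [/cJ//|eJ] := boolP (e \in J); rewrite wc // !inE negb_or eJ.
Qed.

Lemma within_widen (J : {set {set V}}) c : within D c -> within (J :|: D) c.
Proof. by apply: within_sub; apply: subsetUr. Qed.

Lemma homogeneous_ind (X : {set {set V}}) : homogeneous D X 0 (ind H).
Proof.
have /flatP fD := flat_ind ED.
by apply/forall_inP => e eD; rewrite fD // ffunE eqxx; case: ifP.
Qed.

Lemma chain_pair (J : {set {set V}}) c :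
  chain_space D J c -> J \subset [set sx; sy; sz] -> c sx + c sy + c sz = 0.
Proof.
move=> /andP[/is_cycleP cyc wc] sJ; rewrite -bd_hub ?cyc //.
by apply: within_sub wc; apply: setSU.
Qed.

Lemma vertex_spokes2 a b u : a \in H -> b \in H -> within H u ->
  vertex_space H [set spoke w a; spoke w b] u = (u a == 0) && (u b == 0).
Proof.
move=> aH bH wu; rewrite /vertex_space wu /= flatU1 (cobd_spoke wH) //.
congr (_ && _); apply/flatP/eqP => [/(_ (spoke w b))|ub e]; rewrite ?inE ?eqxx.
  by rewrite (cobd_spoke wH) //; apply.
by move=> /eqP ->; rewrite (cobd_spoke wH).
Qed.

Lemma spokes_disj2 a b : [disjoint [set spoke w a; spoke w b] & D].
Proof. exact: (spokes_disjoint wH ED). Qed.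

Lemma spokes_disj1 a : [disjoint [set spoke w a] & D].
Proof. by rewrite disjoints1 spoke_notin. Qed.

Lemma chain_missing a b d c : chain_space D [set spoke w a; spoke w b] c ->
  a \in H -> b \in H -> d \in H -> d != a -> d != b -> c (spoke w d) = 0.
Proof.
move=> /andP[_ /withinP wc] aH bH dH da db; apply: wc.
by rewrite !inE !(spoke_eq wH) // !negb_or da db spoke_notin.
Qed.

(** Balance at the hub makes each chain equal on its two spokes, and it vanishes on the third. If
    one of the chains vanishes on all spokes, it serves. If not, all coefficients are 1 and the sum
    of the three chains cancels on every spoke; a sum of three solutions of an affine system is
    again a solution. *)
Lemma theta_solution (X : {set {set V}}) : X \subset D ->
  theta H D [set sx; sy] [set sx; sz] X != 0 ->
  theta H D [set sx; sz] [set sx; sy] X != 0 ->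
  theta H D [set sy; sz] [set sy; sx] X != 0 ->
  exists c u, [/\ is_cycle c, within D c, within H u & solution D X c u].
Proof.
move=> sXD t1 t2 t3.
have [[c1 [u1 [cc1 /andP[wu1 _] s1]]] _] := theta_neq0 sXD (spokes_disj2 _ _) t1.
have [[c2 [u2 [cc2 /andP[wu2 _] s2]]] _] := theta_neq0 sXD (spokes_disj2 _ _) t2.
have [[c3 [u3 [cc3 /andP[wu3 _] s3]]] _] := theta_neq0 sXD (spokes_disj2 _ _) t3.
have z1 : c1 sz = 0 by apply: (chain_missing cc1); rewrite // eq_sym.
have z2 : c2 sy = 0 by apply: (chain_missing cc2); rewrite // eq_sym.
have z3 : c3 sx = 0 by apply: (chain_missing cc3).
have E1 : c1 sx + c1 sy = 0.
  by rewrite -(chain_pair cc1) ?z1 ?addr0 //; apply: subsetUl.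
have E2 : c2 sx + c2 sz = 0.
  rewrite -(chain_pair cc2) ?z2 ?addr0 //.
  by apply/subsetP => e; rewrite !inE => /orP[] ->; rewrite ?orbT.
have E3 : c3 sy + c3 sz = 0.
  rewrite -(chain_pair cc3) ?z3 ?add0r //.
  by apply/subsetP => e; rewrite !inE => /orP[] ->; rewrite ?orbT.
have eqF2 (a b : 'F_2) : a + b = 0 -> b = a by move=> /eqP; rewrite addr_eq0 F2_oppr => /eqP ->.
have {E1} E1 := eqF2 _ _ E1; have {E2} E2 := eqF2 _ _ E2; have {E3} E3 := eqF2 _ _ E3.
have /andP[y1 w1] := cc1; have /andP[y2 w2] := cc2; have /andP[y3 w3] := cc3.
have [v1|v1] := F2_cases (c1 sx).
  exists c1, u1; split => //; apply: (within_drop w1) => e.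
  by rewrite !inE => /orP[] /eqP ->; rewrite ?E1.
have [v2|v2] := F2_cases (c2 sx).
  exists c2, u2; split => //; apply: (within_drop w2) => e.
  by rewrite !inE => /orP[] /eqP ->; rewrite ?E2.
have [v3|v3] := F2_cases (c3 sy).
  exists c3, u3; split => //; apply: (within_drop w3) => e.
  by rewrite !inE => /orP[] /eqP ->; rewrite ?E3.
exists (c1 + (c2 + c3)), (u1 + (u2 + u3)); split.
- by rewrite !is_cycleD.
- apply: (@within_drop [set sx; sy; sz]).
    rewrite !withinD //; [move: w1|move: w2|move: w3]; apply: within_sub; apply: setSU;
    by apply/subsetP => e; rewrite !inE => /orP[] ->; rewrite ?orbT.
  move=> e; rewrite !inE -orbA => /or3P[] /eqP ->; rewrite !ffunE.
  + by rewrite v1 v2 z3 addr0 F2_addrr.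
  + by rewrite E1 v1 z2 v3 add0r F2_addrr.
  by rewrite z1 E2 v2 E3 v3 add0r F2_addrr.
- by rewrite !withinD.
by rewrite solutionD //; apply: homogeneousD.
Qed.

(* Homogeneous solutions distinguish the three ends pairwise, which is impossible over two values. *)
Lemma theta_pointwise (X : {set {set V}}) : X \subset D ->
  theta H D [set sx; sy] [set sx; sz] X != 0 ->
  theta H D [set sx; sz] [set sx; sy] X != 0 ->
  theta H D [set sy; sz] [set sy; sx] X != 0 ->
  theta H D [set sy; sx] [set sy; sz] X != 0 ->
  theta H D [set sx] [set sx] X = 1.
Proof.
move=> sXD t1 t2 t3 t4.
have [c [u0 [cc wc wu0 s0]]] := theta_solution sXD t1 t2 t3.
have [_ h1] := theta_neq0 sXD (spokes_disj2 _ _) t1.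
have [_ h2] := theta_neq0 sXD (spokes_disj2 _ _) t2.
have [_ h4] := theta_neq0 sXD (spokes_disj2 _ _) t4.
have vx u : within H u -> u x = 0 -> vertex_space H [set sx] u.
  move=> wu ux; have := @vertex_spokes2 x x u xH xH wu.
  by rewrite setUid ux eqxx /= => ->.
have [u [wu ux su]] : exists u, [/\ within H u, u x = 0 & solution D X c u].
  have [ux|ux] := F2_cases (u0 x); first by exists u0.
  exists (u0 + ind H); split; first by rewrite withinD ?within_ind.
    by rewrite ffunE ux (indH xH) F2_addrr.
  by rewrite -[c]addr0 solutionD // homogeneous_ind.
apply: (theta_eq1 sXD (spokes_disj1 _) _ (vx _ wu ux) su).
  by rewrite /chain_space cc within_widen.
move=> k l ck /andP[wl /flatP fl] hkl.
have lx : l x = 0 by rewrite -(cobd_spoke wH wl xH) fl // inE.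
have wk : within D k.
  have /andP[_ w1] := ck; apply: (within_drop w1) => e /set1P ->.
  have := chain_pair ck; rewrite (withinP _ _ w1 sy) ?(withinP _ _ w1 sz); last 2 first.
  - by rewrite !inE (spoke_eq wH) // negb_or eq_sym xz spoke_notin.
  - by rewrite !inE (spoke_eq wH) // negb_or eq_sym xy spoke_notin.
  by rewrite !addr0; apply; apply/subsetP => f; rewrite !inE => ->.
have ck' J : chain_space D J k by move: ck; rewrite /chain_space => /andP[-> _]; rewrite within_widen.
have [lz|lz] := F2_cases (l z).
  by apply: h1; rewrite // vertex_spokes2 // lx lz eqxx.
have [ly|ly] := F2_cases (l y).
  by apply: h2; rewrite // vertex_spokes2 // lx ly eqxx.
(* Now [l] is 1 at [y] and [z] and 0 at [x]. Shifting by the constant makes it vanish at [y] and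
   [z], so the shifted function should be 0, yet it is 1 at [x]. *)
have [] := h4 k (l + ind H).
- exact: ck'.
- by rewrite vertex_spokes2 ?withinD ?within_ind // !ffunE ly lz yH zH F2_addrr eqxx.
- have := homogeneous_ind X; rewrite -[k]addr0 => h0.
  move: hkl h0 => /forall_inP g1 /forall_inP g2; apply/forall_inP => e eD.
  have := g1 e eD; have := g2 e eD; rewrite cobdD !ffunE addr0; case: ifP => _.
    by move=> /eqP <- /eqP <-; rewrite addr0.
  by move=> /eqP -> /eqP ->; rewrite addr0.
move=> _ /ffunP /(_ x); rewrite !ffunE lx xH add0r => /eqP.
by rewrite oner_eq0.
Qed.

End Pointwise.

(** * Sums of polynomials over all points *)

Section CosubsetSums.
Variables (T : finType) (D : {set T}).
Implicit Types (a b : {set T} -> bool) (X F : {set T}).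

(** A multilinear polynomial evaluated at the point with support [X]; the sets satisfying [a] are
    the complements of its monomials. *)
Definition cosum a X : 'F_2 := \sum_(F in powerset D) ((D :\: F \subset X) && a F)%:R.

Lemma eq_cosum a b : (forall F, F \subset D -> a F = b F) -> cosum a =1 cosum b.
Proof.
by move=> ab X; apply: eq_bigr => F; rewrite powersetE => /ab ->.
Qed.

(** Summed over all points, only the monomial containing every variable survives. *)
Lemma sum_cosum a : \sum_(X in powerset D) cosum a X = (a set0)%:R.
Proof.
rewrite /cosum exchange_big /= (bigD1 set0) ?powersetE ?sub0set //= [X in _ + X]big1 ?addr0.
  under eq_bigr => X _ do rewrite -mulnb natrM.
  by rewrite -mulr_suml sum_supersets ?sub0set // eqxx mul1r.
move=> F /andP[]; rewrite powersetE => sFD /negbTE F0.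
under eq_bigr => X _ do rewrite -mulnb natrM.
by rewrite -mulr_suml sum_supersets // F0 mul0r.
Qed.

(** The monomials of [G] and [F] multiply to that of [G :&: F], which survives only if the two sets
    are disjoint; the sizes then force [G = D :\: F]. *)
Lemma sum_cosum_mul a b p q :
  (forall F, F \subset D -> a F -> #|F| = p) -> (forall F, F \subset D -> b F -> #|F| = q) ->
  #|D| = (p + q)%N ->
  \sum_(X in powerset D) cosum a X * cosum b X
  = \sum_(F in powerset D) (a (D :\: F) && b F)%:R.
Proof.
move=> cp cq cD.
transitivity (\sum_(F in powerset D) \sum_(G in powerset D)
   ((G :&: F == set0) && (a G && b F))%:R : 'F_2).
  rewrite /cosum; under eq_bigr => X _ do rewrite mulr_sumr.
  rewrite exchange_big; apply: eq_bigr => F; rewrite powersetE => sFD.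
  under eq_bigr => X _ do rewrite mulr_suml.
  rewrite exchange_big; apply: eq_bigr => G; rewrite powersetE => sGD /=.
  transitivity (\sum_(X in powerset D) (D :\: (G :&: F) \subset X)%:R * (a G && b F)%:R : 'F_2).
    apply: eq_bigr => X _; rewrite -!natrM !mulnb setDIr subUset.
    by rewrite !andbA; congr (_%:R); case: (_ \subset X); case: (_ \subset X); case: (a G).
  rewrite -mulr_suml sum_supersets -?natrM ?mulnb //.
  by apply: subset_trans sGD; apply: subsetIl.
apply: eq_bigr => F; rewrite powersetE => sFD.
rewrite (bigD1 (D :\: F)) ?powersetE ?subsetDl //= big1 ?addr0 => [|G].
  by rewrite setDE -setIA [~: F :&: F]setIC setICr setI0 eqxx.
rewrite powersetE => /andP[sGD GF]; case: eqP => //= GF0.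
have [/andP[aG bF]|//] := boolP (a G && b F); case/eqP: GF; apply/eqP.
have sG : G \subset D :\: F by rewrite subsetD sGD -setI_eq0 GF0 eqxx.
rewrite eqEcard sG cardsDS // cD (cp _ sGD aG) (cq _ sFD bF) addnK leqnn //.
Qed.

End CosubsetSums.

(** If [a], [b], [c] all vanish, the polynomial is the constant [d] with 8 or 0 zeros, and [K] is
    even. Otherwise there are exactly 4 zeros; this balance depends on the linear coefficients
    having sum 0, which is why the third one is [b + c]. *)
Lemma zero_count_8 (a b c d : 'F_2) :
  let v (p q r : 'F_2) : nat :=
    (a * (q * r + p * r + p * q) + b * r + c * q + (b + c) * p + d == 0) in
  exists K : nat,
    (v 0%R 0%R 0%R + v 0%R 0%R 1%R + v 0%R 1%R 0%R + v 0%R 1%R 1%R + v 1%R 0%R 0%R + v 1%R 0%R 1%R + v 1%R 1%R 0%R + v 1%R 1%R 1%R = 4 * K)%N /\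
    K%:R = 1 + (1 + a) * (1 + b) * (1 + c).
Proof.
case: (F2_cases a) => ->; case: (F2_cases b) => ->; case: (F2_cases c) => ->;
case: (F2_cases d) => -> v;
first [by exists 0%N; split; [|apply: val_inj] | by exists 1%N; split; [|apply: val_inj] | by exists 2%N; split; [|apply: val_inj]].
Qed.

Lemma two_forest_sizes (d h : nat) : (d + 3 = 2 * h -> 2 < h ->
  [/\ d = h.-1 + h.-2, 0 < h.-1 & 0 < h.-2])%N.
Proof. by move=> E h2; split; lia. Qed.

Lemma addn_reorder8 (n0 n1 n2 n3 n4 n5 n6 n7 : nat) :
  (n0 + n4 + n2 + n6 + n1 + n5 + n3 + n7 = n0 + n1 + n2 + n3 + n4 + n5 + n6 + n7)%N.
Proof. lia. Qed.

(** * The zeros of the Kirchhoff polynomial near a vertex of degree three *)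

Section StarCount.
Variables (V : finType) (H : {set V}) (D : {set {set V}}) (w : V).
Hypothesis wH : w \notin H.
Hypothesis ED : edges_in H D.

Definition one_spoke (x : V) (F : {set {set V}}) : bool := is_tree H (spoke w x |: F).
Definition two_spokes (x y : V) (F : {set {set V}}) : bool :=
  is_tree H (spoke w x |: (spoke w y |: F)).
(** These are the spanning 2-forests with [x] in one component and both [y] and [z] in the other. *)
Definition joint (x y z : V) (F : {set {set V}}) : bool := two_spokes x y F && two_spokes x z F.

Lemma two_spokesC x y F : two_spokes x y F = two_spokes y x F.
Proof. by rewrite /two_spokes setUCA. Qed.

Lemma theta_joint (x y z : V) (X : {set {set V}}) : x \in H -> y \in H -> z \in H -> x != y -> x != z ->
  theta H D [set spoke w x; spoke w y] [set spoke w x; spoke w z] X = cosum D (joint x y z) X.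
Proof.
move=> xH yH zH xy xz; apply: eq_bigr => F; rewrite powersetE => sFD.
by rewrite /joint /two_spokes (is_tree_two_ways wH ED).
Qed.

(** A joint sum is symmetric in its last two ends, so each of the two assumptions supplies two of
    the four sums required by [theta_pointwise]. *)
Lemma joint_pointwise (x y z : V) (X : {set {set V}}) : X \subset D ->
  x \in H -> y \in H -> z \in H -> x != y -> x != z -> y != z ->
  cosum D (joint x y z) X != 0 -> cosum D (joint y x z) X != 0 -> cosum D (one_spoke x) X = 1.
Proof.
move=> sXD xH yH zH xy xz yz; have yx : y != x by rewrite eq_sym.
have jC a b c : cosum D (joint a b c) X = cosum D (joint a c b) X.
  by apply: eq_cosum => F _; rewrite /joint andbC.
move=> fx fy; apply: (theta_pointwise wH ED xH yH zH xy xz yz sXD).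
- by rewrite (theta_joint _ xH yH zH).
- by rewrite (theta_joint _ xH zH yH) // jC.
- by rewrite (theta_joint _ yH zH xH) // jC.
by rewrite (theta_joint _ yH xH zH).
Qed.

Lemma one_spokeC (x y : V) (X : {set {set V}}) : H != set0 -> x \in H -> y \in H ->
  cosum D (one_spoke x) X = cosum D (one_spoke y) X.
Proof.
move=> H0 xH yH; apply: eq_cosum => F sFD.
by rewrite /one_spoke (is_tree_spoke_indep wH ED sFD xH yH).
Qed.

Section ThreeNeighbours.
Variables x y z : V.
Hypotheses (xH : x \in H) (yH : y \in H) (zH : z \in H).
Hypotheses (xy : x != y) (xz : x != z) (yz : y != z).
Hypothesis cardD : (#|D| + 3 = 2 * #|H|)%N.
Local Notation sx := (spoke w x).
Local Notation sy := (spoke w y).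
Local Notation sz := (spoke w z).

Definition star_graph : {set {set V}} := sx |: (sy |: (sz |: D)).

Let sD b : spoke w b \notin D. Proof. exact: spokeD wH ED b. Qed.
Let szE : sz \notin D. Proof. exact: sD. Qed.
Let syE : sy \notin sz |: D. Proof. by rewrite !inE negb_or (spoke_eq wH) // yz sD. Qed.
Let sxE : sx \notin sy |: (sz |: D).
Proof. by rewrite !inE !negb_or !(spoke_eq wH) // xy xz sD. Qed.
Let H_neq0 : H != set0. Proof. by apply/set0Pn; exists x. Qed.

(** Deletion and contraction of [e]: sets without [e] carry its variable, sets with [e] do not. *)
Lemma cosumU1 (T : finType) (e : T) (E X : {set T}) (P : {set T} -> bool) : e \notin E ->
  cosum (e |: E) P X = (e \in X)%:R * cosum E P X + cosum E (fun F => P (e |: F)) X.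
Proof.
move=> eE; rewrite /cosum big_powersetU1 // big_split mulr_sumr; congr (_ + _);
  apply: eq_bigr => F; rewrite powersetE => sFE.
  have eF : e \notin F by apply: contra eE; apply: (subsetP sFE).
  have -> : (e |: E) :\: F = e |: (E :\: F).
    by apply/setP => f; rewrite !inE; case: eqP => [->|] //=; rewrite eF.
  by rewrite subUset sub1set -natrM mulnb andbA.
have -> // : (e |: E) :\: (e |: F) = E :\: F.
by apply/setP => f; rewrite !inE; case: eqP => [->|] //=; rewrite (negbTE eE) andbF.
Qed.

(** There is no cubic term in the spoke variables, as a tree needs a spoke, and the three quadratic
    coefficients agree, as a single spoke may be attached anywhere. *)
Lemma tree_sum_star (X' X : {set {set V}}) (p q r : 'F_2) :
  (sx \in X')%:R = p -> (sy \in X')%:R = q -> (sz \in X')%:R = r ->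
  (forall A : {set {set V}}, A \subset D -> (A \subset X') = (A \subset X)) ->
  tree_sum H star_graph X' =
  cosum D (one_spoke x) X * (q * r + p * r + p * q)
  + cosum D (two_spokes x y) X * r + cosum D (two_spokes x z) X * q
  + cosum D (two_spokes y z) X * p
  + cosum D (fun F => is_tree H (sx |: (sy |: (sz |: F)))) X.
Proof.
move=> Ep Eq Er EX.
have cX P : cosum D P X' = cosum D P X.
  by apply: eq_bigr => F _; rewrite EX // subsetDl.
have -> : tree_sum H star_graph X' = cosum star_graph (is_tree H) X'.
  by apply: eq_bigr => F _; rewrite andbC.
rewrite /star_graph !cosumU1 // Ep Eq Er !cX.
have -> : cosum D (is_tree H) X = 0.
  by apply: big1 => F; rewrite powersetE => sFD; rewrite (is_tree_no_spoke ED H_neq0 sFD) andbF.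
rewrite -/(one_spoke x) -/(one_spoke y) -/(one_spoke z).
have -> : cosum D (fun F => is_tree H (sz |: F)) X = cosum D (one_spoke x) X by exact: one_spokeC.
have -> : cosum D (fun F => is_tree H (sy |: F)) X = cosum D (one_spoke x) X by exact: one_spokeC.
rewrite -/(two_spokes x y) -/(two_spokes x z) -/(two_spokes y z).
rewrite /one_spoke /two_spokes /=; ring.
Qed.

Lemma two_spokes_split (F : {set {set V}}) : F \subset D ->
  [/\ (two_spokes x y F)%:R = (joint x y z F)%:R + (joint y x z F)%:R :> 'F_2,
      (two_spokes x z F)%:R = (joint x y z F)%:R + (joint z x y F)%:R :> 'F_2 &
      (two_spokes y z F)%:R = (joint y x z F)%:R + (joint z x y F)%:R :> 'F_2].
Proof.
move=> sFD; rewrite /joint [two_spokes y x F]two_spokesC [two_spokes z x F]two_spokesC.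
rewrite [two_spokes z y F]two_spokesC.
have zy : z != y by rewrite eq_sym.
have yx : y != x by rewrite eq_sym.
have zx : z != x by rewrite eq_sym.
have := is_tree_spokes_split wH ED xH yH zH xy xz yz sFD.
have := is_tree_spokes_split wH ED xH zH yH xz xy zy sFD.
have := is_tree_spokes_split wH ED yH zH xH yz yx zx sFD.
rewrite -/(two_spokes x y F) -/(two_spokes x z F) -/(two_spokes y z F).
rewrite -/(two_spokes z y F) -/(two_spokes y x F) -/(two_spokes z x F).
rewrite ![two_spokes y x F]two_spokesC ![two_spokes z x F]two_spokesC.
rewrite ![two_spokes z y F]two_spokesC.
by case: (two_spokes x y F); case: (two_spokes x z F); case: (two_spokes y z F);
  do ?[move=> /(_ isT) //|move=> _]; split; apply: val_inj.
Qed.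

Lemma cosum_split (P Q R : {set {set V}} -> bool) (X : {set {set V}}) :
  (forall F : {set {set V}}, F \subset D -> (P F)%:R = (Q F)%:R + (R F)%:R :> 'F_2) ->
  cosum D P X = cosum D Q X + cosum D R X.
Proof.
move=> E; rewrite /cosum -big_split; apply: eq_bigr => F; rewrite powersetE => /E EF.
by rewrite -!mulnb !natrM EF mulrDr.
Qed.

(** The expanded left side differs from the right by [1 + a] times the products of two of the [fi],
    and [a] is 1 wherever two of them are nonzero. *)
Lemma joint_sum_pointwise (X : {set {set V}}) : X \subset D ->
  let a := cosum D (one_spoke x) X in
  let f1 := cosum D (joint x y z) X in
  let f2 := cosum D (joint y x z) X in
  let f3 := cosum D (joint z x y) X in
  (1 + a) * (1 + (f1 + f2)) * (1 + (f1 + f3)) = (1 + a) * (1 + (f1 + f2 + f3)).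
Proof.
move=> sXD a f1 f2 f3.
have jC t b c : cosum D (joint t b c) X = cosum D (joint t c b) X.
  by apply: eq_cosum => F _; rewrite /joint andbC.
have zy : z != y by rewrite eq_sym.
have zx : z != x by rewrite eq_sym.
have yx : y != x by rewrite eq_sym.
have h12 : f1 != 0 -> f2 != 0 -> a = 1 by exact: joint_pointwise.
have h13 : f1 != 0 -> f3 != 0 -> a = 1.
  by rewrite /f1 jC; exact: joint_pointwise.
have h23 : f2 != 0 -> f3 != 0 -> a = 1.
  rewrite /a (one_spokeC X H_neq0 xH yH) /f2 /f3 jC [cosum D (joint z x y) X]jC.
  exact: joint_pointwise.
move: h12 h13 h23; case: (F2_cases f1) => ->; case: (F2_cases f2) => ->; case: (F2_cases f3) => ->;
case: (F2_cases a) => -> h12 h13 h23; try exact: val_inj.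
- by have := h23 isT isT.
- by have := h13 isT isT.
- by have := h12 isT isT.
by have := h12 isT isT.
Qed.

(** [zero_count_8] is summed over the points of the inner edges. A polynomial with no monomial in
    all variables sums to 0; the products of [a] with a joint sum have full degree because the set
    sizes [#|H|.-1] and [#|H|.-2] add up to [#|D|]. *)
Lemma star_count :
  exists K : nat,
    (\sum_(X in powerset star_graph) (tree_sum H star_graph X == 0%R) = 4 * K)%N /\
    K%:R = \sum_(F in powerset D) (one_spoke x (D :\: F))%:R *
      ((joint x y z F)%:R + (joint y x z F)%:R + (joint z x y F)%:R) :> 'F_2.
Proof.
have H3 : (2 < #|H|)%N.
  have : [set x; y; z] \subset H by apply/subsetP => t; rewrite !inE -orbA => /or3P[] /eqP ->.
  by move/subset_leq_card; rewrite cardsU cards2 xy cards1 (_ : _ :&: _ = set0) ?cards0 //; apply/setP => t; rewrite !inE; apply/negP => /andP[/orP[] /eqP -> /eqP E]; [move: xz|move: yz]; rewrite E eqxx.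
have [cD q1 q2] := two_forest_sizes cardD H3.
pose a := cosum D (one_spoke x); pose b := cosum D (two_spokes x y).
pose c := cosum D (two_spokes x z).
pose d := cosum D (fun F => is_tree H (sx |: (sy |: (sz |: F)))).
have bE X : b X = cosum D (joint x y z) X + cosum D (joint y x z) X.
  by apply: cosum_split => F /two_spokes_split [].
have cE X : c X = cosum D (joint x y z) X + cosum D (joint z x y) X.
  by apply: cosum_split => F /two_spokes_split [].
have eE X : cosum D (two_spokes y z) X = b X + c X.
  rewrite bE cE addrACA F2_addrr add0r.
  by apply: cosum_split => F /two_spokes_split [].
pose v X (p q r : 'F_2) : nat :=
    (a X * (q * r + p * r + p * q) + b X * r + c X * q + (b X + c X) * p + d X == 0).
pose K X : nat := ((v X 0%R 0%R 0%R + v X 0%R 0%R 1%R + v X 0%R 1%R 0%R + v X 0%R 1%R 1%R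
    + v X 1%R 0%R 0%R + v X 1%R 0%R 1%R + v X 1%R 1%R 0%R + v X 1%R 1%R 1%R) %/ 4)%N.
exists (\sum_(X in powerset D) K X)%N; split.
  rewrite big_distrr /star_graph !big_powersetU1 //; apply: eq_bigr => X; rewrite powersetE => sXD.
  have [k [Ek _]] := zero_count_8 (a X) (b X) (c X) (d X).
  have EK : (4 * K X = v X 0%R 0%R 0%R + v X 0%R 0%R 1%R + v X 0%R 1%R 0%R + v X 0%R 1%R 1%R
    + v X 1%R 0%R 0%R + v X 1%R 0%R 1%R + v X 1%R 1%R 0%R + v X 1%R 1%R 1%R)%N.
    by rewrite /K /v Ek mulKn.
  have nX t : spoke w t \notin X by apply: contra (sD t); apply: (subsetP sXD).
  have val (X' : {set {set V}}) (p q r : 'F_2) : (sx \in X')%:R = p -> (sy \in X')%:R = q -> (sz \in X')%:R = r ->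
     (forall A : {set {set V}}, A \subset D -> (A \subset X') = (A \subset X)) ->
     (tree_sum H star_graph X' == 0 : nat) = v X p q r.
    by move=> ep eq er eX; rewrite (tree_sum_star ep eq er eX) eE.
  have sub (e : {set V}) (A B : {set {set V}}) : e \notin D -> A \subset D -> (A \subset e |: B) = (A \subset B).
    move=> eD sAD; apply/subsetP/subsetP => h f fA; last by rewrite inE (h f fA) orbT.
    by have := h f fA; rewrite !inE => /orP[/eqP Ef|//]; move: eD; rewrite -Ef (subsetP sAD).
  rewrite -/star_graph.
  rewrite (val X 0 0 0) ?(negbTE (nX _)) //.
  rewrite (val (sz |: X) 0 0 1) ?inE ?(spoke_eq wH) ?(negbTE xz) ?(negbTE yz) ?eqxx ?(negbTE (nX _)) //; last by move=> A ?; rewrite sub.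
  rewrite (val (sy |: X) 0 1 0) ?inE ?(spoke_eq wH) ?(negbTE xy) ?(eq_sym z) ?(negbTE yz) ?eqxx ?(negbTE (nX _)) //; last by move=> A ?; rewrite sub.
  rewrite (val (sy |: (sz |: X)) 0 1 1) ?inE ?(spoke_eq wH) ?(negbTE xy) ?(negbTE xz) ?(eq_sym z) ?(negbTE yz) ?eqxx ?(negbTE (nX _)) //; last by move=> A ?; rewrite !sub.
  rewrite (val (sx |: X) 1 0 0) ?inE ?(spoke_eq wH) ?(eq_sym _ x) ?(negbTE xy) ?(negbTE xz) ?eqxx ?(negbTE (nX _)) //; last by move=> A ?; rewrite sub.
  rewrite (val (sx |: (sz |: X)) 1 0 1) ?inE ?(spoke_eq wH) ?(eq_sym _ x) ?(negbTE xy) ?(negbTE xz) ?(negbTE yz) ?eqxx ?(negbTE (nX _)) //; last by move=> A ?; rewrite !sub.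
  rewrite (val (sx |: (sy |: X)) 1 1 0) ?inE ?(spoke_eq wH) ?(eq_sym _ x) ?(negbTE xy) ?(negbTE xz) ?(eq_sym z) ?(negbTE yz) ?eqxx ?(negbTE (nX _)) //; last by move=> A ?; rewrite !sub.
  rewrite (val (sx |: (sy |: (sz |: X))) 1 1 1) ?inE ?eqxx ?orbT //; last by move=> A ?; rewrite !sub.
  apply: (eq_trans _ (esym EK)); rewrite !addrA; exact: addn_reorder8.
have cp1 (G : {set {set V}}) : G \subset D -> one_spoke x G -> #|G| = #|H|.-1.
  move=> sGD; rewrite /one_spoke (is_tree_connected wH); last by apply: edges_in_spoke => //; exact: edges_in_widen sGD.
  rewrite cardsU1 (contra (subsetP sGD sx)) ?sD // => /andP[/eqP <- _]; by rewrite add1n.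
have cp2 t s (G : {set {set V}}) : t \in H -> s \in H -> t != s -> G \subset D -> two_spokes t s G -> #|G| = #|H|.-2.
  move=> tH sH ts sGD; rewrite /two_spokes (is_tree_connected wH); last exact: (edges_in_spokes2 wH ED).
  by rewrite (card_spokes2 wH ED) // => /andP[/eqP <- _].
have z0 (P : {set {set V}} -> bool) q : (forall G : {set {set V}}, G \subset D -> P G -> #|G| = q) -> (0 < q)%N -> P set0 = false.
  move=> cP q0; apply/negbTE/negP => /(cP set0 (sub0set _)); rewrite cards0 => E; by rewrite -E in q0.
have zx : z != x by rewrite eq_sym.
have yx : y != x by rewrite eq_sym.
have j1 (G : {set {set V}}) : G \subset D -> joint x y z G -> #|G| = #|H|.-2 by move=> s /andP[h _]; exact: (cp2 x y).
have j2 (G : {set {set V}}) : G \subset D -> joint y x z G -> #|G| = #|H|.-2 by move=> s /andP[h _]; exact: (cp2 y x).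
have j3 (G : {set {set V}}) : G \subset D -> joint z x y G -> #|G| = #|H|.-2 by move=> s /andP[h _]; exact: (cp2 z x).
rewrite natr_sum.
(* The 1 in [zero_count_8] cancels the 1 of the expanded product [(1 + a) * (1 + f)], leaving
   [a + f + a * f]. *)
transitivity (\sum_(X in powerset D) (a X + (cosum D (joint x y z) X + cosum D (joint y x z) X + cosum D (joint z x y) X)
   + (a X * cosum D (joint x y z) X + a X * cosum D (joint y x z) X + a X * cosum D (joint z x y) X))).
  apply: eq_bigr => X; rewrite powersetE => sXD.
  have [k [Ek kE]] := zero_count_8 (a X) (b X) (c X) (d X).
  have -> : K X = k by rewrite /K /v Ek mulKn.
  rewrite kE bE cE (joint_sum_pointwise sXD) -/a.
  by rewrite mulrDl mul1r !mulrDr mulr1 !addrA F2_addrr add0r; ring.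
rewrite !big_split /= !(sum_cosum, sum_cosum_mul cp1 j1 cD, sum_cosum_mul cp1 j2 cD, sum_cosum_mul cp1 j3 cD).
rewrite (z0 _ _ cp1 q1) (z0 _ _ j1 q2) (z0 _ _ j2 q2) (z0 _ _ j3 q2) !add0r.
rewrite -!big_split; apply: eq_bigr => F _ /=.
by rewrite -!mulnb !natrM !mulrDr.
Qed.

End ThreeNeighbours.
End StarCount.

(** * Complementary forests and cuts *)

Lemma setDK (T : finType) (A B : {set T}) : B \subset A -> A :\: (A :\: B) = B.
Proof. by move=> sBA; rewrite setDDr setDv set0U; apply/setIidPr. Qed.

Lemma big_powerset_compl (R : nmodType) (T : finType) (D : {set T}) (f : {set T} -> R) :
  \sum_(F in powerset D) f F = \sum_(F in powerset D) f (D :\: F).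
Proof.
rewrite (reindex_onto (fun F => D :\: F) (fun F => D :\: F)) /=; last first.
  by move=> F; rewrite powersetE; exact: setDK.
apply: eq_bigl => F; rewrite !powersetE subsetDl /=.
apply/eqP/idP => [<-|]; [exact: subsetDl|exact: setDK].
Qed.

Lemma two_forest_card (d h f : nat) : (d + 3 = 2 * h -> f <= d -> (d - f).+1 = h -> f.+2 = h)%N.
Proof. lia. Qed.

Section Cuts.
Variables (V : finType) (H : {set V}) (D : {set {set V}}) (r : V).
Hypothesis rH : r \in H.
Hypothesis ED : edges_in H D.
Hypothesis cardD : (#|D| + 3 = 2 * #|H|)%N.
Implicit Types (u t : {ffun V -> 'F_2}) (F T : {set {set V}}).

Definition cut u : {set {set V}} := [set e in D | cobd u e != 0].
(** A bipartition of [H] is given by two functions that differ by [ind H]; vanishing at [r] selects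
    one. *)
Definition normalized u : bool := within (H :\ r) u.
Definition coforests F : bool := acyclic (D :\: F) && acyclic F.
Definition flat_coforests u : 'F_2 := \sum_(F in powerset D) (coforests F && flat F u)%:R.
(** For nonzero normalized [u] the edge number leaves no slack: the cut is a spanning tree and the
    edges inside the two sides form a tree on each side. *)
Definition acyclic_cut u : bool := acyclic (cut u) && acyclic (D :\: cut u).

Lemma coforestsE F : coforests F = acyclic (D :\: F) && acyclic F.
Proof. by []. Qed.

Lemma cut_sub u : cut u \subset D.
Proof. by apply/subsetP => e; rewrite inE => /andP[]. Qed.

Lemma flat_cut F u : F \subset D -> flat F u = (F \subset D :\: cut u).
Proof.
move=> sFD; apply/flatP/subsetP => h e eF; first by rewrite !inE (h e eF) eqxx andbF (subsetP sFD).
by have := h e eF; rewrite !inE => /andP[]; case: (e \in D) => //=; rewrite negbK => /eqP.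
Qed.

Lemma edges_in_sub F : F \subset D -> edges_in H F.
Proof. by move=> sFD; apply: edges_in_subset ED. Qed.

Lemma normalizedD u t : normalized u -> normalized t -> normalized (u + t).
Proof. exact: withinD. Qed.

Lemma normalized_root u : normalized u -> u r = 0.
Proof. by move=> /withinP; apply; rewrite !inE eqxx. Qed.

Lemma acyclic_flat_card F u : F \subset D -> acyclic F -> normalized u -> u != 0 -> flat F u ->
  (#|F|.+2 <= #|H|)%N.
Proof.
move=> sFD aF wu u0 fu; have := acyclic_card rH (edges_in_sub sFD) aF.
rewrite leq_eqVlt => /orP[/eqP E|//].
have := acyclic_connected rH (edges_in_sub sFD) E; rewrite aF => /esym/connectedP /(_ u wu fu) Eu.
by rewrite Eu eqxx in u0.
Qed.

(** Each part has at most [#|H| - 1] edges and together they have [2 * #|H| - 3], so one part is a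
    tree and the other lacks one edge. *)
Lemma coforests_card F : F \subset D -> coforests F ->
  (#|D :\: F|.+1 = #|H| /\ #|F|.+2 = #|H|) \/ (#|D :\: F|.+2 = #|H| /\ #|F|.+1 = #|H|).
Proof.
move=> sFD /andP[aT aF]; have := acyclic_card rH (edges_in_sub sFD) aF.
have := acyclic_card rH (edges_in_sub (subsetDl D F)) aT.
have := subset_leq_card sFD; rewrite cardsDS //; move: cardD; lia.
Qed.

Lemma coforests_flat_card F u : F \subset D -> coforests F -> normalized u -> u != 0 -> flat F u ->
  #|D :\: F|.+1 = #|H| /\ #|F|.+2 = #|H|.
Proof.
move=> sFD cF nu u0 fu; have [//|[_ E]] := coforests_card sFD cF.
have := acyclic_flat_card sFD (proj2 (andP cF)) nu u0 fu.
by rewrite -E ltnn.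
Qed.

Lemma acyclic_cut_card u : normalized u -> u != 0 -> acyclic_cut u -> #|cut u|.+1 = #|H|.
Proof.
move=> nu u0 /andP[a1 a2].
have fl : flat (D :\: cut u) u by rewrite flat_cut ?subsetDl.
have cf : coforests (D :\: cut u) by rewrite /coforests setDK ?cut_sub // a1.
by have [] := coforests_flat_card (subsetDl _ _) cf nu u0 fl; rewrite setDK ?cut_sub.
Qed.

(* Translating by a cycle inside [N], or inside the complement of [A :|: N], pairs up the terms of the expansion over cycles. *)
Lemma coforest_sum_even (A N : {set {set V}}) (z : {ffun {set V} -> 'F_2}) :
  [disjoint A & N] -> A :|: N \subset D -> is_cycle z -> z != 0 ->
  within N z || within (D :\: (A :|: N)) z ->
  \sum_(F : {set {set V}} | (A \subset F) && (F \subset A :|: N)) (coforests F)%:R = 0 :> 'F_2.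
Proof.
move=> dAN sAND cz z0 wz.
transitivity (\sum_(F : {set {set V}} | (A \subset F) && (F \subset A :|: N))
    (\sum_(y : {ffun {set V} -> 'F_2} | is_cycle y) [forall e, (e \notin F) ==> (y e == 0)]%:R) *
    (\sum_(y : {ffun {set V} -> 'F_2} | is_cycle y && within D y) [forall e, (e \in F) ==> (y e == 0)]%:R) : 'F_2).
  apply: eq_bigr => F /andP[sAF sFAN]; have sFD := subset_trans sFAN sAND.
  rewrite /coforests andbC -mulnb natrM; congr (_ * _); first exact: acyclic_sum.
  rewrite acyclic_sum big_mkcond [RHS]big_mkcond; apply: eq_bigr => y _.
  case: (is_cycle y) => //=.
  have -> : within (D :\: F) y = within D y && [forall e, (e \in F) ==> (y e == 0)]; last by case: within.
  apply/withinP/andP => [h|[/withinP h1 /forall_inP h2] e].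
    split; first by apply/withinP => e eD; apply: h; rewrite inE (negbTE eD) andbF.
    by apply/forall_inP => e eF; rewrite h // inE eF.
  by rewrite inE negb_and negbK => /orP[/h2/eqP|/h1].
rewrite sum_complementary //.
(* A cycle inside [N] is added to both expansion variables, which occur on [N] only through their
   sum. A cycle outside [A :|: N] is added to the second variable alone, which does not occur
   there. *)
pose k1 : {ffun {set V} -> 'F_2} := if within N z then z else 0.
have wD : within D z.
  case/orP: wz; apply: within_sub; last exact: subsetDl.
  by apply: subset_trans sAND; apply: subsetUr.
apply: (F2_sum2_translate (k1 := k1) (k2 := z)); rewrite ?z0 ?orbT //.
- apply: F2_closed_translate => [f g|]; first exact: is_cycleD.
  by rewrite /k1; case: ifP; rewrite ?cz ?is_cycle0.
- apply: F2_closed_translate => [f g /andP[? ?] /andP[? ?]|]; first by rewrite is_cycleD ?withinD.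
  by rewrite cz.
move=> f g; apply: eq_bigr => e _; rewrite !ffunE /k1.
case: (boolP (within N z)) => [/withinP wN|nN].
  case: (boolP (e \in N)) => eN; first by rewrite addrACA F2_addrr addr0.
  by rewrite (wN e) // !addr0.
move: wz; rewrite (negbTE nN) /= => /withinP wC; rewrite ffunE !addr0.
case: (boolP (e \in A)) => eA.
  by rewrite (wC e) ?addr0 // !inE eA.
by case: (boolP (e \in N)) => // eN; rewrite (wC e) ?addr0 // !inE eN orbT.
Qed.

Lemma nacyclicP F : ~~ acyclic F ->
  exists z : {ffun {set V} -> 'F_2}, [/\ is_cycle z, z != 0 & within F z].
Proof.
by move=> /forallPn [z]; rewrite negb_imply => /andP[/andP[? ?] ?]; exists z.
Qed.

(** If cut and complement are acyclic, the sizes leave [D :\: cut u] as the only summand. If one of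
    them contains a cycle, [coforest_sum_even] applies with nothing forced into [F] and
    [D :\: cut u] as the free part. *)
Lemma flat_coforests_cut u : normalized u -> u != 0 -> flat_coforests u = (acyclic_cut u)%:R.
Proof.
move=> nu u0; have [gu|ngu] := boolP (acyclic_cut u).
  have [a1 a2] := andP gu.
  rewrite /flat_coforests (bigD1 (D :\: cut u)) ?powersetE ?subsetDl //=.
  rewrite /coforests setDK ?cut_sub // a1 a2 flat_cut ?subsetDl // subxx big1 ?addr0 // => F.
  rewrite powersetE => /andP[sFD neF]; case: (boolP (_ && _)) => // /andP[cF fu].
  case/eqP: neF; have [cT _] := coforests_flat_card sFD cF nu u0 fu.
  have := acyclic_cut_card nu u0 gu; rewrite -cT => -[Ec].
  rewrite -(setDK sFD); congr (_ :\: _); apply/eqP; rewrite eq_sym eqEcard Ec leqnn andbT.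
  rewrite flat_cut // in fu; rewrite subsetD cut_sub /= disjoint_sym.
  by move: fu; rewrite subsetD => /andP[].
have sN : set0 :|: (D :\: cut u) \subset D by rewrite set0U subsetDl.
transitivity (\sum_(F : {set {set V}} | (set0 \subset F) && (F \subset set0 :|: (D :\: cut u)))
    (coforests F)%:R : 'F_2).
  rewrite /flat_coforests big_mkcond [RHS]big_mkcond; apply: eq_bigr => F _.
  rewrite powersetE sub0set set0U /=.
  have [sFN|nFN] := boolP (F \subset D :\: cut u).
    have sFD := subset_trans sFN (subsetDl _ _).
    by rewrite sFD flat_cut // sFN andbT.
  by case: ifP => // sFD; rewrite flat_cut // (negbTE nFN) andbF.
have [z [cz z0 wz]] : exists z : {ffun {set V} -> 'F_2},
    [/\ is_cycle z, z != 0 & within (D :\: cut u) z || within (cut u) z].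
  move: ngu; rewrite negb_and => /orP[] /nacyclicP [z [? ? ?]]; exists z; split => //.
    by apply/orP; right.
  by apply/orP; left.
apply: (coforest_sum_even _ sN cz z0); first by rewrite -setI_eq0 set0I.
by rewrite set0U setDK ?cut_sub.
Qed.

(** A forest with this number of edges has two components, hence exactly two normalized flat
    functions; [u0] is the partition into these components. *)
Lemma normalized_flatE F u0 :
  F \subset D -> coforests F -> #|F|.+2 = #|H| -> normalized u0 -> u0 != 0 -> flat F u0 ->
  forall u, normalized u && flat F u = (u == 0) || (u == u0).
Proof.
move=> sFD /andP[_ aF] cF nu0 u00 fu0.
have := acyclic_nflat rH (edges_in_sub sFD) aF; rewrite -cF [RHS]expnS => /eqP.
rewrite eqn_pmul2r ?expn_gt0 // => /eqP n2.
have sub : [set (0 : {ffun V -> 'F_2}); u0] \subset [set u | within (H :\ r) u & flat F u].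
  by apply/subsetP => u; rewrite !inE => /orP[] /eqP ->; rewrite ?within0 ?flat0 // fu0 andbT.
have /eqP E : [set (0 : {ffun V -> 'F_2}); u0] == [set u | within (H :\ r) u & flat F u].
  by rewrite eqEcard sub -/(nflat H r F) n2 cards2 eq_sym u00.
by move=> u; have /setP /(_ u) := E; rewrite !inE => ->.
Qed.


Lemma sum_normalized_flat F (phi : {ffun V -> 'F_2} -> 'F_2) (u0 : {ffun V -> 'F_2}) :
  F \subset D -> coforests F -> #|F|.+2 = #|H| -> normalized u0 -> u0 != 0 -> flat F u0 ->
  \sum_(u | normalized u && flat F u) phi u = phi 0 + phi u0.
Proof.
move=> sFD cF cardF nu0 u00 fu0.
rewrite (eq_bigl _ _ (normalized_flatE sFD cF cardF nu0 u00 fu0)).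
rewrite (bigD1 (0 : {ffun V -> 'F_2})) ?eqxx //= (big_pred1 u0) // => u.
by have [->|_] := eqVneq u 0; rewrite /= ?andbT // eq_sym (negbTE u00).
Qed.

Lemma exists_flat F : F \subset D -> #|F|.+2 = #|H| ->
  exists u0, [/\ normalized u0, u0 != 0 & flat F u0].
Proof.
move=> sFD cardF; have : ~~ connected (H :\ r) F.
  by apply/negP => /(connected_card rH (edges_in_sub sFD)); rewrite -cardF ltnn.
move=> /forallPn [u]; rewrite negb_imply => /andP[/andP[? ?] ?].
by exists u.
Qed.

Section TwoSpokes.
Variable w : V.
Hypothesis wH : w \notin H.

Lemma two_spokes_flat F u0 (a b : V) : F \subset D -> coforests F -> #|F|.+2 = #|H| ->
  normalized u0 -> u0 != 0 -> flat F u0 -> a \in H -> b \in H -> a != b ->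
  two_spokes H w a b F = (u0 a != u0 b).
Proof.
move=> sFD cF cardF nu0 u00 fu0 aH bH ab.
rewrite /two_spokes (is_tree_connected wH); last exact: (edges_in_spokes2 wH ED).
rewrite (card_spokes2 wH ED) // cardF eqxx /=.
have nfl := normalized_flatE sFD cF cardF nu0 u00 fu0.
have wu0 : within H u0 by apply: within_sub nu0; apply: subsetDl.
have f1 := flat_indD ED sFD; have w1 := within_ind H.
apply/connectedP/idP => [c|/eqP ne t wt].
  apply/eqP => E; have z a' (t : {ffun V -> 'F_2}) : within H t -> flat F t -> t a = 0 -> t b = 0 -> t a' = 0.
    move=> wt ft ta tb; rewrite (c t) ?ffunE //.
    by rewrite (flat_spokes2 wH) // ta tb ft eqxx.
  have [ua|ua] := F2_cases (u0 a).
    case/eqP: u00; apply/ffunP => a'; rewrite ffunE; apply: z => //; by rewrite -E.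
  have := z r (u0 + ind H); rewrite !ffunE (normalized_root nu0) -E ua aH bH rH F2_addrr add0r.
  move=> /(_ (withinD wu0 w1) (flatD fu0 f1) erefl erefl) /eqP; by rewrite oner_eq0.
rewrite (flat_spokes2 wH) // => /and3P[/eqP ta /eqP tb ft].
have [tr|tr] := F2_cases (t r).
  have nt : normalized t.
    apply/withinP => x; rewrite !inE negb_and negbK => /orP[/eqP -> //|]; exact: (withinP _ _ wt).
  have := nfl t; rewrite nt ft => /esym/orP[/eqP //|/eqP E]; by case: ne; rewrite -E ta tb.
have nt : normalized (t + ind H).
  apply/withinP => x; rewrite !inE negb_and negbK !ffunE => /orP[/eqP ->|xH].
    by rewrite tr rH F2_addrr.
  by rewrite (withinP _ _ wt) // (negbTE xH) add0r.
have := nfl (t + ind H); rewrite nt flatD // => /esym/orP[/eqP E|/eqP E].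
  have := congr1 (fun f : {ffun V -> 'F_2} => f a) E; rewrite !ffunE ta aH add0r => /eqP.
  by rewrite oner_eq0.
by case: ne; rewrite -E !ffunE ta tb aH bH.
Qed.

Lemma one_spoke_cotree F (x : V) : F \subset D -> x \in H ->
  one_spoke H w x (D :\: F) = (#|D :\: F|.+1 == #|H|) && acyclic (D :\: F).
Proof.
move=> sFD xH; have sT := subsetDl D F.
have sp : spoke w x \notin D :\: F by apply: contra (spokeD wH ED x); apply: (subsetP sT).
rewrite /one_spoke (is_tree_connected wH); last by apply: edges_in_spoke => //; exact: edges_in_widen sT.
rewrite cardsU1 sp add1n; case: eqP => //= E.
rewrite (acyclic_connected xH (edges_in_sub sT) E).
apply/connectedP/connectedP => c u wu => [fu|].
  have wu' : within H u by apply: within_sub wu; apply: subsetDl.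
  apply: c => //; rewrite flatU1 fu andbT (cobd_spoke wH) //.
  by rewrite (withinP _ _ wu) // !inE eqxx.
rewrite flatU1 (cobd_spoke wH) // => /andP[/eqP ux fu]; apply: c => //.
apply/withinP => t; rewrite !inE negb_and negbK => /orP[/eqP -> //|]; exact: (withinP _ _ wu).
Qed.

Definition split3 (x y z : V) u : 'F_2 := (~~ ((u x == u y) && (u x == u z)))%:R.

Lemma split3_0 x y z : split3 x y z 0 = 0.
Proof. by rewrite /split3 !ffunE eqxx. Qed.

(** For a tree complementary to a 2-forest, only 0 and the component partition [u0] are flat, and 0
    splits nothing. If [u0] splits the three ends, exactly one of them is alone on its side, so
    exactly one of the joint conditions holds. For all other [F] both sides vanish. *)
Lemma joint_split (x y z : V) F : F \subset D -> x \in H -> y \in H -> z \in H ->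
  x != y -> x != z -> y != z ->
  (one_spoke H w x (D :\: F))%:R *
    ((joint H w x y z F)%:R + (joint H w y x z F)%:R + (joint H w z x y F)%:R)
  = \sum_(u | normalized u) split3 x y z u * (coforests F && flat F u)%:R.
Proof.
move=> sFD xH yH zH xy xz yz; rewrite one_spoke_cotree //.
transitivity ((coforests F)%:R * \sum_(u | normalized u && flat F u) split3 x y z u); last first.
  rewrite mulr_sumr big_mkcondr; apply: eq_bigr => u _.
  by case: (flat F u); rewrite ?andbF ?andbT ?mulr0 // mulrC.
have [/andP[cF /eqP cardF]|nc] := boolP (coforests F && (#|F|.+2 == #|H|)).
  have [u0 [nu0 u00 fu0]] := exists_flat sFD cardF.
  have [-> _] := coforests_flat_card sFD cF nu0 u00 fu0.
  have [aT aF] := andP cF; rewrite eqxx aT cF !mul1r (sum_normalized_flat _ sFD cF cardF nu0 u00 fu0).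
  have tE := two_spokes_flat sFD cF cardF nu0 u00 fu0.
  rewrite split3_0 add0r /joint !tE // 1?eq_sym // /split3.
  by case: (F2_cases (u0 x)) => ->; case: (F2_cases (u0 y)) => ->; case: (F2_cases (u0 z)) => ->;
    apply: val_inj.
have -> : (coforests F)%:R * (\sum_(u | normalized u && flat F u) split3 x y z u) = 0.
  have [cF|] := boolP (coforests F); last by rewrite mul0r.
  rewrite mul1r; apply: big1 => u /andP[nu fu].
  have [->|u0] := eqVneq u 0; first exact: split3_0.
  have [_ E] := coforests_flat_card sFD cF nu u0 fu.
  by rewrite cF E eqxx in nc.
have [/andP[/eqP cT aT]|] := boolP (_ && _); last by rewrite mul0r.
have cardF : #|F|.+2 = #|H|.
  by apply: (two_forest_card cardD (subset_leq_card sFD)); rewrite -cT cardsDS.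
have two (a b : V) : two_spokes H w a b F = false.
  apply/negbTE/negP => /andP[aF _]; case/negP: nc; rewrite /coforests aT cardF eqxx !andbT /=.
  by apply: acyclic_subset aF; apply: subset_trans (subsetUr _ _) (subsetUr _ _).
by rewrite /joint !two !addr0 mulr0.
Qed.

End TwoSpokes.

End Cuts.

Lemma two_tree_sizes (d h f n : nat) : (d + 3 = 2 * h -> f <= d -> h <= (d - f).+1 -> h <= f.+2 ->
  (d - f).+1 = h /\ f.+2 = h)%N.
Proof. lia. Qed.

Lemma too_many_edges (d h k : nat) : (d + 3 = 2 * h -> 5 <= h -> h = 1 + k -> d - 3 < k -> False)%N.
Proof. lia. Qed.

Lemma succ_conflict (k h : nat) : (k.+2 = h -> k.+1 = h -> False)%N.
Proof. lia. Qed.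

Lemma card_sub_le3 (T : finType) (S A : {set T}) : #|S| = 3%N ->
  [\/ #|S :&: A| = 0, #|S :&: A| = 1, #|S :&: A| = 2 | #|S :&: A| = 3]%N.
Proof.
move=> S3; have := subset_leq_card (subsetIl S A); rewrite S3.
case: #|_| => [|[|[|[|//]]]] _; [apply: Or41|apply: Or42|apply: Or43|apply: Or44]; by [].
Qed.

Definition incident (V : finType) (D : {set {set V}}) (a : V) : {set {set V}} :=
  [set e in D | a \in e].

Lemma mem_incident (V : finType) (D : {set {set V}}) (a : V) (e : {set V}) :
  (e \in incident D a) = (e \in D) && (a \in e).
Proof. by rewrite inE. Qed.

(** * Parity of the number of acyclic cuts *)

Section Parity.
Variables (V : finType) (H : {set V}) (D : {set {set V}}) (r : V).
Hypothesis rH : r \in H.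
Hypothesis ED : edges_in H D.
Hypothesis cardD : (#|D| + 3 = 2 * #|H|)%N.
Implicit Types (u t : {ffun V -> 'F_2}) (F T : {set {set V}}).

Local Notation normalized := (normalized H r).
Local Notation coforests := (coforests D).
Local Notation acyclic_cut := (acyclic_cut D).

(** This undoes the grouping by bipartitions. The function 0 has to stay out, since every edge set
    is flat for it. *)
Lemma acyclic_cut_sum (P : pred {ffun V -> 'F_2}) : ~~ P 0 ->
  \sum_(u | normalized u && P u) (acyclic_cut u)%:R =
  \sum_(F in powerset D) \sum_(u | normalized u && P u) (coforests F && flat F u)%:R :> 'F_2.
Proof.
move=> P0; rewrite exchange_big /=; apply: eq_bigr => u /andP[nu Pu].
rewrite -(flat_coforests_cut rH ED cardD nu) //.
by apply: contraNneq P0 => <-.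
Qed.

(** If [d] is odd, [F] has at most two components, and then connectedness of [D :\: F] forces the
    sizes of a tree and a 2-forest. The gain is that connectedness, unlike acyclicity, expands over
    vertex functions, the same kind of object as [u]. *)
Lemma separating_connected F (x : V) : F \subset D -> x \in H ->
  let d := \sum_(u | normalized u && (u x == 1)) (flat F u)%:R : 'F_2 in
  (coforests F)%:R * d = (connected (H :\ r) (D :\: F))%:R * d.
Proof.
move=> sFD xH d; have [->|d1] := F2_cases d; first by rewrite !mulr0.
have [u0 [nu0 ux fu0]] : exists u0, [/\ normalized u0, u0 x = 1 & flat F u0].
  have [/existsP [u /andP[/andP[nu /eqP ux] fu]]|/existsPn h] :=
    boolP [exists u, (normalized u && (u x == 1)) && flat F u]; first by exists u.
  move: d1; rewrite /d big1 => [/esym/eqP|u nu]; first by rewrite oner_eq0.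
  by have := h u; rewrite nu /= => /negbTE ->.
have u00 : u0 != 0 by apply/eqP => E; move/eqP: ux; rewrite E ffunE eq_sym oner_eq0.
(* A nonzero such [u] would pair off the terms of the odd sum [d], because adding it keeps the value
   1 at [x]. *)
have hom u : normalized u -> u x = 0 -> flat F u -> u = 0.
  move=> nu ux0 fu; apply/eqP/negPn/negP => un0.
  move: d1; rewrite /d.
  rewrite (eq_bigr (fun t => if flat F t then 1 else 0)); last by move=> t _; case: flat.
  rewrite -big_mkcondr (F2_sum_translate un0) => [/esym/eqP|t]; first by rewrite oner_eq0.
  rewrite !ffunE ux0 addr0.
  have -> : normalized (t + u) = normalized t.
    by apply: (F2_closed_translate (P := normalized)) => // f g; exact: normalizedD.
  have -> // : flat F (t + u) = flat F t.
  by apply: (F2_closed_translate (P := flat F)) => // f g; exact: flatD.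
have n2 : (nflat H r F <= 2)%N.
  rewrite /nflat; apply: (@leq_trans #|[set (0 : {ffun V -> 'F_2}); u0]|); last by rewrite cards2; case: (_ != _).
  apply/subset_leq_card/subsetP => u; rewrite !inE => /andP[nu fu].
  have [uz|uz] := F2_cases (u x); first by rewrite (hom u) ?eqxx.
  rewrite -subr_eq0 -[u == u0]subr_eq0 subr0; apply/orP; right; apply/eqP.
  have -> : u - u0 = u + u0 by apply/ffunP => v; rewrite !ffunE F2_oppr.
  by apply: hom; rewrite ?normalizedD ?flatD // ffunE uz ux F2_addrr.
have ET := edges_in_sub ED (subsetDl D F); have EF := edges_in_sub ED sFD.
have hF : (#|H| <= #|F|.+2)%N.
  rewrite -(leq_exp2l (m := 2)) //; apply: (@leq_trans (nflat H r F * 2 ^ #|F|.+1)).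
    by rewrite (flat_cycle_card rH EF) leq_pmulr // ncycle_gt0.
  by rewrite [(2 ^ #|F|.+2)%N]expnS leq_mul2r n2 orbT.
congr (_%:R * _); congr nat_of_bool; apply/idP/idP => [cF|cT].
  have [cT _] := coforests_flat_card rH ED cardD sFD cF nu0 u00 fu0.
  by rewrite -(acyclic_connected rH ET cT); case/andP: cF.
have lT := connected_card rH ET cT; rewrite cardsDS // in lT.
have [cT' cF'] := two_tree_sizes 0 cardD (subset_leq_card sFD) lT hF.
rewrite coforestsE (acyclic_connected rH ET) ?cT ?cardsDS //=.
have := flat_cycle_card rH EF; rewrite -cF' [in RHS]expnS => E.
rewrite (acyclicE F) eqn_leq (ncycle_gt0 F) andbT.
rewrite -(@leq_pmul2l (2 ^ #|F|.+2)) ?expn_gt0 // muln1 expnS -E.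
by rewrite leq_mul2r n2 orbT.
Qed.

(** Both factors are now sums over vertex functions and meet on each edge of [D] only in the sum of
    their coboundaries. Adding the indicator of one further vertex [z] to both functions changes
    neither this sum nor the values at [x] and [r]. *)
Lemma acyclic_cut_separating_even (x z : V) : x \in H -> z \in H -> x != r -> z != r -> z != x ->
  \sum_(u | normalized u && (u x == 1)) (acyclic_cut u)%:R = 0 :> 'F_2.
Proof.
move=> xH zH xr zr zx; rewrite acyclic_cut_sum; last by rewrite ffunE eq_sym oner_eq0.
pose f1 t e : 'F_2 := (e \in D)%:R * cobd t e.
transitivity (\sum_(F : {set {set V}} | (set0 \subset F) && (F \subset set0 :|: D))
    (\sum_(t | normalized t) [forall e, (e \notin F) ==> (f1 t e == 0)]%:R) *
    (\sum_(u | normalized u && (u x == 1)) [forall e, (e \in F) ==> (cobd u e == 0)]%:R) : 'F_2).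
  apply: eq_big => [F|F]; first by rewrite powersetE sub0set set0U.
  rewrite powersetE => sFD.
  under eq_bigr => u _ do rewrite -mulnb natrM.
  rewrite -mulr_sumr separating_connected //; congr (_ * _).
  rewrite connected_sum; apply: eq_bigr => t _; congr (nat_of_bool _)%:R.
  apply/flatP/forallP => h e.
    apply/implyP => eF; rewrite /f1; have [eD|] := boolP (e \in D); last by rewrite mul0r.
    by rewrite mul1r h ?inE ?eF.
  by rewrite inE => /andP[eF eD]; have := h e; rewrite eF /f1 eD mul1r => /eqP.
rewrite sum_complementary; last by rewrite -setI_eq0 set0I.
pose k := ind [set z].
have nk : normalized k.
  apply/withinP => v; rewrite !inE negb_and negbK ffunE inE => /orP[/eqP ->|vH].
    by rewrite eq_sym (negbTE zr).
  by rewrite (_ : v == z = false) //; apply: contraNF vH => /eqP ->.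
have kx : k x = 0 by rewrite ffunE inE eq_sym (negbTE zx).
have nT t : normalized (t + k) = normalized t.
  by apply: (F2_closed_translate (P := normalized)) => // f g; exact: normalizedD.
apply: (F2_sum2_translate (k1 := k) (k2 := k)) => //.
- apply/orP; left; apply/eqP => /ffunP /(_ z); rewrite !ffunE !inE eqxx => /eqP.
  by rewrite oner_eq0.
- by move=> t; rewrite nT [(t + k) x]ffunE kx addr0.
move=> t u; apply: eq_bigr => e _; rewrite /f1 !cobdD in_set0.
case: (e \in D); last by rewrite !mul0r.
by rewrite !mul1r addrACA F2_addrr addr0.
Qed.

Section DegreeThree.
Variable a : V.
Hypotheses (aH : a \in H) (ar : a != r) (H5 : (5 <= #|H|)%N).
Local Notation star := (incident D a).
Hypothesis star3 : #|star| = 3%N.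

Lemma star_sub : star \subset D.
Proof. by apply/subsetP => e; rewrite mem_incident => /andP[]. Qed.

(** Without the star there remain [2 * #|H| - 6] edges on [#|H| - 1] vertices, too many for a forest
    once [#|H|] is at least 5. The resulting cycle lies in the free part, and [coforest_sum_even]
    applies with [e] forced into [T]. *)
Lemma star_coforests (e : {set V}) : e \in star ->
  \sum_(T in powerset D) (coforests T && (star :&: T == [set e]))%:R = 0 :> 'F_2.
Proof.
move=> es; have eD := subsetP star_sub e es.
have sAN : [set e] :|: D :\: star \subset D by rewrite subUset sub1set eD subsetDl.
have dAN : [disjoint [set e] & D :\: star] by rewrite disjoints1 in_setD es.
have /nacyclicP [z [cz z0 wz]] : ~~ acyclic (D :\: star).
  have E' : edges_in (H :\ a) (D :\: star).
    move=> f; rewrite in_setD mem_incident negb_and => /andP[fa fD]; rewrite fD /= in fa.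
    by have [fH f2] := ED fD; rewrite subsetD1 fH fa.
  have rHa : r \in H :\ a by rewrite !inE eq_sym ar.
  apply/negP => /(acyclic_card rHa E').
  rewrite (cardsDS star_sub) star3; apply: (too_many_edges cardD H5).
  by rewrite (cardsD1 a H) aH.
transitivity (\sum_(T : {set {set V}} | ([set e] \subset T) && (T \subset [set e] :|: D :\: star))
   (coforests T)%:R : 'F_2).
  rewrite big_mkcond [RHS]big_mkcond; apply: eq_bigr => T _; rewrite powersetE.
  have -> : ([set e] \subset T) && (T \subset [set e] :|: D :\: star) =
     (T \subset D) && (star :&: T == [set e]).
    apply/andP/andP => [[sT Ts]|[TD /eqP E]]; split.
    - exact: subset_trans Ts sAN.
    - rewrite eqEsubset subsetI sT sub1set es !andbT.
      apply/subsetP => f /setIP[fs fT]; have := subsetP Ts f fT.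
      by rewrite in_setU in_setD fs orbF.
    - by rewrite -E subsetIr.
    apply/subsetP => f fT; rewrite in_setU in_setD (subsetP TD f fT) andbT -E inE fT andbT.
    by case: (f \in star).
  by case: (T \subset D) => //=; case: (_ == _); rewrite ?andbT ?andbF.
by apply: (coforest_sum_even dAN sAN cz z0); rewrite wz.
Qed.

(** The sum counts the partitions into a tree and a 2-forest, which are sorted by the number of star
    edges in the tree. None is impossible, three contribute an even number, and the cases of one and
    two together ask that one of the parts contain exactly one star edge, which is even by
    [star_coforests]. *)
Lemma acyclic_cut_even : \sum_(u | normalized u && (u != 0)) (acyclic_cut u)%:R = 0 :> 'F_2.
Proof.
rewrite acyclic_cut_sum ?eqxx //.
pose p T := coforests T && (#|T|.+1 == #|H|).
have coC F : F \subset D -> coforests (D :\: F) = coforests F.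
  by move=> sFD; rewrite coforestsE setDK // andbC.
have pC F : F \subset D -> p (D :\: F) = coforests F && (#|F|.+2 == #|H|).
  move=> sFD; rewrite /p coC //; have [cF|//] := boolP (coforests F).
  have [[-> ->]|[E1 E2]] := coforests_card rH ED cardD sFD cF; first by rewrite !eqxx.
  by apply/eqP/eqP => E; [case: (succ_conflict E1 E)|case: (succ_conflict E E2)].
transitivity (\sum_(T in powerset D) (p T)%:R : 'F_2).
  rewrite [RHS]big_powerset_compl; apply: eq_bigr => F; rewrite powersetE => sFD.
  rewrite pC //; have [cF|] := boolP (coforests F); last by move=> _; rewrite big1.
  case: eqP => [cardF|ncF] /=.
    have [u0 [nu0 u00 fu0]] := exists_flat rH ED sFD cardF.
    rewrite big_mkcondr /=.
    rewrite (eq_bigr (fun u => (u != 0)%:R * (flat F u)%:R)); last first.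
      by move=> u _; case: (u != 0); rewrite ?mul1r ?mul0r.
    transitivity (\sum_(u | normalized u && flat F u) (u != 0)%:R : 'F_2).
      rewrite [RHS]big_mkcondr; apply: eq_bigr => u _.
      by case: (flat F u); rewrite ?mulr1 ?mulr0.
    rewrite (sum_normalized_flat rH ED (fun u => (u != 0)%:R) sFD cF cardF nu0 u00 fu0).
    by rewrite eqxx u00 add0r.
  apply: big1 => u /andP[nu u0]; have [fu|//] := boolP (flat F u).
  by have [_] := coforests_flat_card rH ED cardD sFD cF nu u0 fu.
have cT T : T \subset D -> ((p T)%:R : 'F_2) = (p T && (#|star :&: T| == 1)%N)%:R
   + (p T && (#|star :&: T| == 2)%N)%:R + (p T && (star \subset T))%:R.
  move=> sTD; have [pT|] := boolP (p T); last by rewrite !addr0.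
  have -> : (star \subset T) = (#|star :&: T| == 3)%N.
    apply/idP/eqP => [/setIidPl -> //|c3]; apply/setIidPl/eqP.
    by rewrite eqEcard subsetIl c3 star3.
  have [c|->|->|->] := card_sub_le3 T star3; rewrite /= ?addr0 ?add0r //.
  (* A tree without star edges would leave [a] isolated, so the indicator of [a] would be flat on
     it. *)
  case/andP: pT => /andP[_ aT] /eqP cT; have := acyclic_connected rH (edges_in_sub ED sTD) cT.
  rewrite aT => /esym/connectedP /(_ (ind [set a])) h.
  have /ffunP /(_ a) : ind [set a] = 0.
    apply: h.
      apply/withinP => v; rewrite !inE negb_and negbK ffunE inE => /orP[/eqP ->|vH].
        by rewrite eq_sym (negbTE ar).
      by rewrite (_ : v == a = false) //; apply: contraNF vH => /eqP ->.
    apply/flatP => e eT; rewrite cobd_ind (_ : _ :&: e = set0) ?cards0 //.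
    apply/eqP; rewrite setI_eq0 disjoints1; apply/negP => ae.
    move/eqP: c; rewrite cards_eq0 => /eqP /setP /(_ e).
    by rewrite !inE (subsetP sTD) // ae eT.
  by rewrite !ffunE inE eqxx => /eqP; rewrite oner_eq0.
rewrite (eq_bigr _ (fun T (TD : T \in powerset D) => cT T (etrans (esym (powersetE _ _)) TD))).
rewrite !big_split /=.
(* Two star edges in the tree means one in the 2-forest, so taking complements makes the 2-forest
   the summation variable. *)
have -> : \sum_(T in powerset D) (p T && (#|star :&: T| == 2)%N)%:R =
   \sum_(T in powerset D) ((coforests T && (#|T|.+2 == #|H|)) && (#|star :&: T| == 1)%N)%:R :> 'F_2.
  rewrite big_powerset_compl; apply: eq_bigr => F; rewrite powersetE => sFD.
  rewrite pC //; congr (_ && _)%:R.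
  have -> : star :&: (D :\: F) = star :\: F.
    by apply/setP => e; rewrite !inE; case: (e \in F); case: (e \in D); case: (a \in e).
  by have := cardsID F star; rewrite star3; case: #|_ :&: F| => [|[|[|[|n]]]]; case: #|_ :\: F| => [|[|[|[|m]]]].
(* If the tree contains the whole star, [a] is a component of the 2-forest, so these partitions
   belong to the cut of [a]. It has 3 edges, fewer than the [#|H| - 1] of a spanning tree. *)
have -> : \sum_(T in powerset D) (p T && (star \subset T))%:R = 0 :> 'F_2.
  pose u0 := ind [set a].
  have nu0 : normalized u0.
    apply/withinP => v; rewrite !inE negb_and negbK ffunE inE => /orP[/eqP ->|vH].
      by rewrite eq_sym (negbTE ar).
    by rewrite (_ : v == a = false) //; apply: contraNF vH => /eqP ->.
  have u00 : u0 != 0 by apply/eqP => /ffunP /(_ a); rewrite !ffunE inE eqxx => /eqP; rewrite oner_eq0.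
  have cob e : cobd u0 e = (a \in e)%:R.
    rewrite cobd_ind; case: (boolP (a \in e)) => ae.
      by rewrite (setIidPl _) ?sub1set // cards1.
    by rewrite (_ : _ :&: _ = set0) ?cards0 //; apply/eqP; rewrite setI_eq0 disjoints1.
  have cutE : cut D u0 = star.
    by apply/setP => e; rewrite !inE cob; case: (a \in e).
  transitivity (flat_coforests D u0).
    rewrite big_powerset_compl; apply: eq_bigr => F; rewrite powersetE => sFD.
    have fE : flat F u0 = (star \subset D :\: F).
      by rewrite (flat_cut _ sFD) cutE !subsetD sFD star_sub /= disjoint_sym.
    rewrite fE pC // -andbA; congr (_%:R); congr nat_of_bool.
    have [cF|//] := boolP (coforests F); rewrite /= -fE.
    have [fu|] := boolP (flat F u0); rewrite ?andbF ?andbT //.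
    by have [_ ->] := coforests_flat_card rH ED cardD sFD cF nu0 u00 fu; rewrite eqxx.
  rewrite (flat_coforests_cut rH ED cardD nu0 u00).
  have [gu|//] := boolP (acyclic_cut u0); have := acyclic_cut_card rH ED cardD nu0 u00 gu.
  by rewrite cutE star3 => E; move: H5; rewrite -E.
rewrite addr0 -big_split /=.
transitivity (\sum_(T in powerset D) \sum_(e in star) (coforests T && (star :&: T == [set e]))%:R : 'F_2).
  apply: eq_bigr => T; rewrite powersetE => sTD; rewrite /p.
  have [cF|nc] := boolP (coforests T); last by rewrite addr0 big1.
  rewrite /=; have [/cards1P [e E]|n1] := boolP (#|star :&: T| == 1)%N; last first.
    rewrite !andbF addr0 big1 // => e es; case: eqP => // E; by rewrite E cards1 in n1.
  have es : e \in star by have := set11 e; rewrite -E => /setIP[].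
  rewrite !andbT (bigD1 e) //= E eqxx big1 ?addr0 => [|f /andP[_ fe]].
    have [[E1 E2]|[E1 E2]] := coforests_card rH ED cardD sTD cF.
      have -> : (#|T|.+1 == #|H|) = false by by apply/eqP => E'; case: (succ_conflict E2 E').
      by rewrite E2 eqxx add0r.
    have -> : (#|T|.+2 == #|H|) = false by apply/eqP => E'; case: (succ_conflict E' E2).
    by rewrite E2 eqxx addr0.
  by case: eqP => // /set1_inj Ef; rewrite Ef eqxx in fe.
rewrite exchange_big big1 //= => e es; exact: star_coforests.
Qed.

End DegreeThree.
End Parity.

(** * The 4-regular graph *)

Lemma card3P (T : finType) (A : {set T}) : #|A| = 3%N ->
  exists x y z, [/\ A = [set x; y; z], x != y, x != z & y != z].
Proof.
move=> A3; have : size (enum A) = 3%N by rewrite -cardE.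
have := enum_uniq A; case E : (enum A) => [|x [|y [|z [|]]]] //= /and3P[] .
rewrite !inE negb_or => /andP[xy xz] yz _ _; exists x, y, z; split => //.
by apply/setP => t; rewrite -mem_enum E !inE orbA.
Qed.

(** The strict bounds on [i] and [j] are attained, [i = s - 1] and [j = h - s - 1], since
    [i + j = h - 2]. Substituting [i] and [c] in the degree sum gives the claim. *)
Lemma cut_sizes (d c i j s h a b : nat) :
  (d + 3 = 2 * h -> c.+1 = h -> d = c + i + j -> i < s -> s <= h -> j < h - s ->
   4 * s = c + 2 * i + a + b -> 2 * s + 3 = h + a + b)%N.
Proof. lia. Qed.

(** The hypotheses give [s = k + (a + b) / 2] with [a + b] even, so the right side has the parity of
    [a + (a + b) / 2]. The odd order enters through the integrality of [k]. *)
Lemma split_parity (h k s a b : nat) : (h = 2 * k + 3 -> 2 * s + 3 = h + a + b -> a <= 3 -> b <= 3 ->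
  odd ((0 < a < 3) + (0 < b < 3)) = odd (s + a + k))%N.
Proof.
case: a => [|[|[|[|//]]]]; case: b => [|[|[|[|//]]]] => /= E1 E2 _ _; lia.
Qed.

Section Neighbours.
Variables (V : finType) (adj : rel V).
Hypothesis adj_sym : symmetric adj.
Hypothesis adj_irr : irreflexive adj.
Hypothesis four_reg : forall x : V, #|[set y | adj x y]| = 4%N.
Variables v w : V.
Hypothesis vw : adj v w.

Definition hull : {set V} := [set: V] :\ v :\ w.
Definition inner_edges : {set {set V}} := edge_set adj hull.
Definition outer (p q : V) : {set V} := [set y | adj p y] :\ q.
Local Notation H := hull.
Local Notation D := inner_edges.
Local Notation nA := (outer v w).
Local Notation nB := (outer w v).

Lemma mem_hull x : (x \in H) = (x != v) && (x != w).
Proof. by rewrite !inE andbT andbC. Qed.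

Lemma inner_edges_in : edges_in H D.
Proof. exact: edges_in_edge_set. Qed.

Lemma outer_card p q : adj p q -> #|outer p q| = 3%N.
Proof.
move=> pq; have := cardsD1 q [set y | adj p y]; rewrite four_reg inE pq.
by case.
Qed.

Lemma outer_v_sub : nA \subset H.
Proof.
apply/subsetP => x; rewrite mem_hull !inE => /andP[-> /(adj_neq adj_irr)].
by rewrite eq_sym => ->.
Qed.

Lemma outer_w_sub : nB \subset H.
Proof.
apply/subsetP => x; rewrite mem_hull !inE => /andP[-> /(adj_neq adj_irr)].
by rewrite eq_sym => ->.
Qed.

Lemma incident_card x : x \in H ->
  (#|incident D x| + (x \in nA) + (x \in nB) = 4)%N.
Proof.
move=> xH; have /andP[xv xw] : (x != v) && (x != w) by rewrite -mem_hull.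
have -> : incident D x = [set [set x; y] | y in [set y in H | adj x y]].
  apply/setP => e; rewrite mem_incident; apply/andP/imsetP => [[/edge_setP [a [b [aH bH ab ->]]]]|[y]].
    rewrite !in_set2 => /orP[] /eqP Ex; first by exists b; rewrite ?Ex //; apply/setIdP.
    by exists a; rewrite ?Ex; [apply/setIdP; rewrite adj_sym|rewrite setUC].
  rewrite inE => /andP[yH xy] ->; split; last by rewrite !inE eqxx.
  by apply/edge_setP; exists x, y.
rewrite card_in_imset => [|y y']; last first.
  rewrite !inE => /andP[_ xy] /andP[_ xy'] /setP E; have := E y; rewrite !inE eqxx orbT.
  by rewrite eq_sym (negbTE (adj_neq adj_irr xy)) => /esym/eqP.
rewrite -(four_reg x) (cardsD1 v [set y | adj x y]) (cardsD1 w ([set y | adj x y] :\ v)) !inE.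
have -> : [set y in H | adj x y] = [set y | adj x y] :\ v :\ w.
  by apply/setP => y; rewrite !inE andbT andbA.
rewrite xv xw (eq_sym w) (adj_neq adj_irr vw) /= ![adj x _]adj_sym; lia.
Qed.

(** Double counting of the edges at vertices of [S]; those leading to [v] or [w] are counted by [nA]
    and [nB]. *)
Lemma degree_sum (S : {set V}) : S \subset H ->
  (4 * #|S| = \sum_(e in D) #|S :&: e| + #|S :&: nA| + #|S :&: nB|)%N.
Proof.
move=> sSH.
have -> : (4 * #|S| = \sum_(x in S) (#|incident D x| + (x \in nA) + (x \in nB)))%N.
  rewrite mulnC -sum_nat_const; apply: eq_bigr => x xS.
  by rewrite incident_card // (subsetP sSH).
have cI (A : {set V}) : (\sum_(x in S) (x \in A) = #|S :&: A|)%N.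
  rewrite -sum1_card [in RHS]big_mkcond /= big_mkcond; apply: eq_bigr => x _.
  by rewrite inE; case: (x \in S) => //=; case: (x \in A).
rewrite !big_split /= !cI; congr (_ + _ + _)%N.
transitivity (\sum_(x in S) \sum_(e in D) (x \in e))%N.
  apply: eq_bigr => x _; rewrite -sum1_card big_mkcond [RHS]big_mkcond.
  by apply: eq_bigr => e _; rewrite mem_incident; case: (e \in D) => //=; case: (x \in e).
rewrite exchange_big; apply: eq_bigr => e _; exact: cI.
Qed.

Lemma inner_edges_card : (#|D| + 3 = 2 * #|H|)%N.
Proof.
have := degree_sum (subxx H).
rewrite (setIidPr outer_v_sub) (setIidPr outer_w_sub) !outer_card // 1?adj_sym //.
rewrite (eq_bigr (fun=> 2%N)) => [|e eD].
  by rewrite sum_nat_const; lia.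
by have [eH e2] := inner_edges_in eD; rewrite (setIidPr eH) e2.
Qed.

Definition supp1 (u : {ffun V -> 'F_2}) : {set V} := [set x | u x == 1].

Lemma ind_supp1 u : u = ind (supp1 u).
Proof. by apply/ffunP => x; rewrite ffunE inE; case: (F2_cases (u x)) => ->. Qed.

(** In the degree sum of one side, cut edges count once and edges inside the side twice. [I] and [J]
    are the edges inside the two sides, and as both are acyclic the edge total fixes their
    numbers. *)
Lemma acyclic_cut_sizes (r : V) u : r \in H -> normalized H r u -> u != 0 -> acyclic_cut D u ->
  (2 * #|supp1 u| + 3 = #|H| + #|supp1 u :&: nA| + #|supp1 u :&: nB|)%N.
Proof.
move=> rH nu u0 gu; set S := supp1 u.
have uE x : u x = (x \in S)%:R by rewrite {1}(ind_supp1 u) ffunE.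
have sSH : S \subset H.
  apply/subsetP => x xS; apply: contraLR xS => xH; rewrite inE (withinP _ _ nu) //.
  by rewrite in_setD1 (negbTE xH) andbF.
have rS : r \notin S by rewrite inE (normalized_root nu).
have [s sS] : exists s, s \in S.
  by have [x ux] := F2_ffun_neq0 u0; exists x; rewrite inE ux.
pose I := [set e in D | e \subset S]; pose J := [set e in D | e \subset H :\: S].
have cobE e : cobd u e = #|S :&: e|%:R by rewrite {1}(ind_supp1 u) cobd_ind.
have cE e : e \in D -> (#|S :&: e| = (e \in cut D u) + 2 * (e \in I))%N /\
    ((e \in cut D u) + (e \in I) + (e \in J) = 1)%N.
  move=> eD; have [eH e2] := inner_edges_in eD.
  have -> : (e \in cut D u) = odd #|S :&: e|.
    by rewrite /cut in_set eD cobE F2_natr; case: (odd _).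
  have -> : (e \in I) = (e \subset S) by rewrite in_set eD.
  have -> : (e \in J) = (e \subset H :\: S) by rewrite in_set eD.
  have := cardsID S e; rewrite e2 setIC.
  have -> : (e \subset S) = (#|e :\: S| == 0)%N by rewrite cards_eq0 setD_eq0.
  have -> : (e \subset H :\: S) = (#|S :&: e| == 0)%N.
    by rewrite subsetD eH /= cards_eq0 setI_eq0 disjoint_sym.
  by case: #|S :&: e| => [|[|[|n]]]; case: #|e :\: S| => [|[|[|m]]].
have sumI (P : {set {set V}}) : P \subset D -> (\sum_(e in D) (e \in P) = #|P|)%N.
  move=> /setIidPr PD; rewrite -{2}PD -sum1_card big_mkcond [RHS]big_mkcond.
  by apply: eq_bigr => e _; rewrite in_setI; case: (e \in D) => //=; case: (e \in P).
have sI : I \subset D by apply/subsetP => e; rewrite inE => /andP[].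
have sJ : J \subset D by apply/subsetP => e; rewrite inE => /andP[].
have [a1 a2] := andP gu.
have dI : I \subset D :\: cut D u.
  apply/subsetP => e eI; have eD := subsetP sI e eI; rewrite inE eD andbT.
  by have [_] := cE e eD; rewrite eI; case: (e \in cut D u).
have dJ : J \subset D :\: cut D u.
  apply/subsetP => e eJ; have eD := subsetP sJ e eJ; rewrite inE eD andbT.
  by have [_] := cE e eD; rewrite eJ; case: (e \in cut D u); rewrite ?addn1.
have lI : (#|I| < #|S|)%N.
  apply: (acyclic_card sS) (acyclic_subset dI a2) => e.
  by rewrite inE => /andP[/inner_edges_in [_ ->] ->].
have lJ : (#|J| < #|H| - #|S|)%N.
  rewrite -cardsDS //; apply: (@acyclic_card _ _ r) (acyclic_subset dJ a2).
    by rewrite inE rS.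
  by move=> e; rewrite inE => /andP[/inner_edges_in [_ ->] ->].
have sizeD : (#|D| = #|cut D u| + #|I| + #|J|)%N.
  rewrite -(sumI _ (cut_sub D u)) -(sumI _ sI) -(sumI _ sJ) -!big_split -sum1_card /=.
  by apply: eq_bigr => e /cE [].
have deg := degree_sum sSH.
rewrite (eq_bigr (fun e => (e \in cut D u) + 2 * (e \in I)))%N in deg; last by move=> e /cE [].
rewrite big_split /= -big_distrr /= !sumI // ?cut_sub // in deg.
apply: (cut_sizes inner_edges_card (acyclic_cut_card rH inner_edges_in inner_edges_card nu u0 gu) sizeD lI
  (subset_leq_card sSH) lJ deg).
Qed.

Lemma split3E (S : {set V}) (x y z : V) u : x != y -> x != z -> y != z -> S = supp1 u ->
  split3 x y z u = (0 < #|S :&: [set x; y; z]| < 3)%N%:R.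
Proof.
move=> xy xz yz ->.
have -> : #|supp1 u :&: [set x; y; z]| = ((x \in supp1 u) + (y \in supp1 u) + (z \in supp1 u))%N.
  rewrite -sum1_card big_mkcond /=.
  transitivity (\sum_(t in [set x; y; z]) (t \in supp1 u))%N.
    rewrite [RHS]big_mkcond; apply: eq_bigr => t _; rewrite inE.
    by case: (t \in [set x; y; z]); rewrite ?andbF ?andbT //; case: (t \in supp1 u).
  have nx : x \notin [set y; z] by rewrite !inE negb_or xy.
  have ny : y \notin [set z] by rewrite inE.
  by rewrite -setUA big_setU1 //= big_setU1 //= big_set1 addnA.
rewrite /split3 !inE.
by case: (F2_cases (u x)) => ->; case: (F2_cases (u y)) => ->; case: (F2_cases (u z)) => ->.
Qed.

End Neighbours.

Lemma hullC (V : finType) (v w : V) : hull w v = hull v w.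
Proof. by apply/setP => x; rewrite !mem_hull andbC. Qed.

Lemma inner_edgesC (V : finType) (adj : rel V) (v w : V) :
  inner_edges adj w v = inner_edges adj v w.
Proof. by rewrite /inner_edges hullC. Qed.

Lemma odd_order_ge (h : nat) : (odd h.+2 -> 4 <= h -> 5 <= h)%N.
Proof. lia. Qed.

Lemma odd_hull (h : nat) : (odd h.+2 -> 3 <= h -> exists k, h = 2 * k + 3)%N.
Proof. by move=> o h3; exists ((h - 3)./2); lia. Qed.

(** * Comparison of two adjacent vertices *)

Section Adjacent.
Variables (V : finType) (adj : rel V).
Hypothesis adj_sym : symmetric adj.
Hypothesis adj_irr : irreflexive adj.
Hypothesis four_reg : forall x : V, #|[set y | adj x y]| = 4%N.

Definition splits (A : {set V}) (u : {ffun V -> 'F_2}) : bool := (0 < #|supp1 u :&: A| < 3)%N.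

(** After deletion of [v], the vertex [w] is the hub of a star of three spokes over [H], so the
    point count becomes a sum over partitions and, exchanging the summations, over acyclic cuts. *)
Lemma c2_del_cut_sum (v w r : V) : adj v w -> r \in hull v w ->
  (c2_del adj 2 v)%:R =
  \sum_(u | normalized (hull v w) r u) (splits (outer adj w v) u)%:R * (acyclic_cut (inner_edges adj v w) u)%:R
  :> 'F_2.
Proof.
move=> vw rH; set H := hull v w in rH *; set D := inner_edges adj v w.
have wv : adj w v by rewrite adj_sym.
have [x [y [z [EB xy xz yz]]]] := card3P (outer_card four_reg wv).
have BH b : b \in outer adj w v -> b \in H by apply: (subsetP (outer_w_sub adj_irr v w)).
have xH : x \in H by apply: BH; rewrite EB !inE eqxx.
have yH : y \in H by apply: BH; rewrite EB !inE eqxx orbT.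
have zH : z \in H by apply: BH; rewrite EB !inE eqxx orbT.
have wH : w \notin H by rewrite mem_hull eqxx andbF.
have ED : edges_in H D := @inner_edges_in _ _ adj_irr v w.
have cD : (#|D| + 3 = 2 * #|H|)%N := inner_edges_card adj_sym adj_irr four_reg vw.
set S := [set: V] :\ v.
have wS : w \in S by rewrite !inE andbT eq_sym (adj_neq adj_irr).
have ES : edge_set adj S = star_graph D w x y z.
  have sB b : (b \in outer adj w v) = (b == x) || (b == y) || (b == z) by rewrite EB !inE.
  have star b : b \in outer adj w v -> [set w; b] \in edge_set adj S.
    move=> bB; apply/edge_setP; exists w, b; split => //; last by move: bB; rewrite !inE => /andP[].
    by move: (BH b bB); rewrite mem_hull !inE => /andP[->].
  apply/setP => e; rewrite /star_graph !in_setU !in_set1 -!/(spoke w _).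
  apply/idP/or4P => [/edge_setP [a [b [aS bS ab ->]]]|[/eqP->|/eqP->|/eqP->|]]; last 1 first.
  - move=> /edge_setP [a [b [aH bH ab ->]]]; apply/edge_setP; exists a, b.
    by move: aH bH; rewrite !mem_hull !inE => /andP[-> _] /andP[-> _].
  - have spo c : adj w c -> c \in S -> [\/ spoke w c == spoke w x, spoke w c == spoke w y,
       spoke w c == spoke w z | spoke w c \in D].
      move=> wc; rewrite !inE => cS; have : c \in outer adj w v by rewrite !inE wc; case/andP: cS => ->.
      by rewrite sB -orbA => /or3P[] /eqP ->; [apply: Or41|apply: Or42|apply: Or43].
    have [aw|aw] := eqVneq a w; first by rewrite aw; apply: spo; rewrite -?aw.
    have [bw|bw] := eqVneq b w.
      by rewrite bw setUC; apply: spo; rewrite // -bw adj_sym.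
    apply: Or44; apply/edge_setP; exists a, b.
    by move: aS bS; rewrite !mem_hull !inE !andbT => -> ->.
  - by apply: star; rewrite sB eqxx.
  - by apply: star; rewrite sB eqxx orbT.
  by apply: star; rewrite sB eqxx orbT.
have [K [EK KE]] := star_count wH ED xH yH zH xy xz yz cD.
(* The point count is exactly [4 * K], so the truncated division in [c2] returns [K]. *)
have -> : (c2_del adj 2 v)%:R = K%:R :> 'F_2.
  rewrite /c2_del /c2 (psi_countE adj_irr wS) ES -/H EK mulKn // modn2.
  by rewrite [RHS]F2_natr.
rewrite KE; transitivity (\sum_(F in powerset D) \sum_(u | normalized H r u)
    split3 x y z u * (coforests D F && flat F u)%:R).
  by apply: eq_bigr => F; rewrite powersetE => sFD; rewrite (joint_split rH ED cD wH).
rewrite exchange_big; apply: eq_bigr => u nu; rewrite -mulr_sumr /=.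
rewrite (split3E xy xz yz erefl) -EB /splits.
(* At [u = 0] the number of partitions need not agree with the cut indicator, but 0 splits
   nothing. *)
have [->|u0] := eqVneq u 0; last by rewrite -(flat_coforests_cut rH ED cD nu u0).
have -> : supp1 (0 : {ffun V -> 'F_2}) = set0.
  by apply/setP => t; rewrite !inE ffunE eq_sym oner_eq0.
by rewrite set0I cards0 !mul0r.
Qed.

Lemma c2_del_adjacent (v w : V) : odd #|V| -> adj v w -> c2_del adj 2 v = c2_del adj 2 w.
Proof.
move=> oddV vw; have wv : adj w v by rewrite adj_sym.
set H := hull v w; set D := inner_edges adj v w.
set nA := outer adj v w; set nB := outer adj w v.
suff E : (c2_del adj 2 v)%:R = (c2_del adj 2 w)%:R :> 'F_2.
  have lt2 t : (c2_del adj 2 t < 2)%N by rewrite /c2_del /c2 ltn_mod.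
  have := congr1 val E; move: (lt2 v) (lt2 w).
  by case: (c2_del adj 2 v) => [|[|?]]; case: (c2_del adj 2 w) => [|[|?]].
have cA : #|nA| = 3%N := outer_card four_reg vw.
have cB : #|nB| = 3%N := outer_card four_reg wv.
have ED : edges_in H D := @inner_edges_in _ _ adj_irr v w.
have cD : (#|D| + 3 = 2 * #|H|)%N := inner_edges_card adj_sym adj_irr four_reg vw.
have sA : nA \subset H := outer_v_sub adj_irr v w.
have sB : nB \subset H := outer_w_sub adj_irr v w.
have cV : #|V| = #|H|.+2.
  have := cardsD1 v [set: V]; rewrite inE cardsT => ->; have := cardsD1 w ([set: V] :\ v).
  by rewrite !inE andbT eq_sym (adj_neq adj_irr) // => ->.
rewrite cV in oddV.
(* Exchanging [v] and [w] keeps [H] and [D] and replaces one set of outer neighbours by the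
   other. *)
have E r : r \in H -> (c2_del adj 2 w)%:R =
    \sum_(u | normalized H r u) (splits nA u)%:R * (acyclic_cut D u)%:R :> 'F_2.
  move=> rH; have := @c2_del_cut_sum w v r wv; rewrite hullC inner_edgesC; exact.
have [AB|AB] := eqVneq nA nB.
  have /set0Pn [r rA] : nA != set0 by rewrite -card_gt0 cA.
  have rH := subsetP sA r rA; rewrite (c2_del_cut_sum vw rH) (E r rH).
  by apply: eq_bigr => u _; rewrite -/nB -AB.
(* Such an [a] is adjacent to [v] but not to [w], so it has degree three in [H], as required for the
   total to be even. *)
have [a aA aB] : exists2 a, a \in nA & a \notin nB.
  apply/subsetPn; apply: contra AB => sAB; by rewrite eqEcard sAB cA cB.
have aH := subsetP sA a aA.
have H4 : (4 <= #|H|)%N.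
  (* The vertex [a] and the three vertices of [nB] give four vertices; the odd order excludes
     equality. *)
  apply: (@leq_trans #|a |: nB|); first by rewrite cardsU1 aB cB.
  by apply: subset_leq_card; rewrite subUset sub1set aH.
have H5 := odd_order_ge oddV H4.
have [r rH ra] : exists2 r, r \in H & a != r.
  have /set0Pn [r] : H :\ a != set0 by rewrite -card_gt0; have := cardsD1 a H; rewrite aH; case: #|H :\ a| => // Ha; move: H4; rewrite Ha.
  by rewrite in_setD1 eq_sym => /andP[? ?]; exists r.
have star3 : #|incident D a| = 3%N.
  have := incident_card adj_sym adj_irr four_reg vw aH; rewrite -/nA -/nB aA (negbTE aB) addn0 addn1.
  by case.
have Qeven := acyclic_cut_even rH ED cD aH ra H5 star3.
rewrite (c2_del_cut_sum vw rH) (E r rH) -/nB -/H -/D.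
apply/eqP; rewrite -subr_eq0 F2_oppr -big_split /=; apply/eqP.
have [k Ek] := odd_hull oddV (ltnW H4).
(* The first two sums are the sizes of [supp1 u] and of its intersection with [nA], so the weight is
   affine in [u] and can be summed vertex by vertex. *)
transitivity (\sum_(u | normalized H r u && (u != 0))
   ((\sum_(t in H) (u t == 1)%:R) + (\sum_(t in nA) (u t == 1)%:R) + k%:R) * (acyclic_cut D u)%:R : 'F_2).
  rewrite [RHS]big_mkcondr; apply: eq_bigr => u nu.
  have [->|u0] := eqVneq u 0.
    rewrite /splits (_ : supp1 _ = set0) ?set0I ?cards0 ?mul0r ?addr0 //.
    by apply/setP => t; rewrite !inE ffunE eq_sym oner_eq0.
  rewrite /= -mulrDl; have [gu|_] := boolP (acyclic_cut D u); last by rewrite !mulr0.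
  congr (_ * _).
  have sz := acyclic_cut_sizes adj_sym adj_irr four_reg vw rH nu u0 gu.
  have sumE (X : {set V}) : \sum_(t in X) (u t == 1)%:R = #|supp1 u :&: X|%:R :> 'F_2.
    rewrite -sum1_card natr_sum big_mkcond [RHS]big_mkcond; apply: eq_bigr => t _.
    by rewrite inE inE; case: (t \in X); rewrite ?andbF //; case: (u t == 1).
  rewrite !sumE (setIidPl _); last first.
    apply/subsetP => t; rewrite inE; apply: contraLR => tH.
    by rewrite (withinP _ _ nu) // in_setD1 (negbTE tH) andbF.
  rewrite -!natrD F2_natr [RHS]F2_natr; congr (nat_of_bool _)%:R; rewrite addnC.
  apply: (split_parity Ek sz); first by rewrite -cA subset_leq_card ?subsetIr.
  by rewrite -cB subset_leq_card ?subsetIr.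
under eq_bigr => u _ do rewrite !mulrDl !mulr_suml.
have sep t : t \in H -> \sum_(u | normalized H r u && (u != 0)) (u t == 1)%:R * (acyclic_cut D u)%:R = 0 :> 'F_2.
  move=> tH; transitivity (\sum_(u | normalized H r u && (u t == 1)) (acyclic_cut D u)%:R : 'F_2).
    rewrite big_mkcondr [RHS]big_mkcondr; apply: eq_bigr => u _.
    have [->|_] := eqVneq u 0; first by rewrite ffunE eq_sym oner_eq0.
    by case: (u t == 1); rewrite ?mul1r ?mul0r.
  (* A normalized function never takes the value 1 at the root; for other [t] a third vertex [s] is
     available for the translation. *)
  have [->|tr] := eqVneq t r.
    by apply: big1 => u /andP[nu]; rewrite (normalized_root nu) eq_sym oner_eq0.
  have /set0Pn [s] : H :\ t :\ r != set0.
    rewrite -card_gt0; have := cardsD1 t H; have := cardsD1 r (H :\ t).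
    rewrite tH in_setD1 eq_sym tr rH; case: #|H :\ t :\ r| => // -> Ht; by move: H4; rewrite Ht.
  rewrite in_setD1 => /andP[sr]; rewrite in_setD1 => /andP[st sH].
  exact: (acyclic_cut_separating_even rH ED cD tH sH tr sr st).
rewrite !big_split /= exchange_big big1 /=; last by move=> t tH; exact: sep.
rewrite exchange_big big1 /=; last by move=> t tA; apply: sep; exact: (subsetP sA).
by rewrite -mulr_sumr Qeven mulr0 !addr0.
Qed.

End Adjacent.

Local Close Scope ring_scope.

Theorem theorem1p2 (V : finType) (adj : rel V)
  (adj_sym : symmetric adj) (adj_irr : irreflexive adj)
  (four_reg : forall x : V, #|[set y | adj x y]| = 4)
  (conn : forall x y : V, connect adj x y)
  (odd_order : odd #|V|)
  (v w : V) :
  c2_del adj 2 v = c2_del adj 2 w.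
Proof.
have /connectP [p] := conn v w.
elim: p v => [|x p IH] v /=; first by move=> _ ->.
move=> /andP[vx xp] Ew; rewrite -(IH x xp Ew).
exact: c2_del_adjacent.
Qed.
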